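(* Let $b\in[\mathbb H^\infty_d]_1$ be non-column-extreme and let $a\in[\mathbb H^\infty_d]_1$ be its unique Sarason function. Then $a$ is the maximal outer factor of $T=I-b(R)^*b(R)$. In particular, $$a(0)^2=\inf_{\substack{p\in\mathbb C\{\mathfrak z\} \\ p(0)=0}}\big\langle1-p,(I-b(R)^*b(R))(1-p)\big\rangle_{\mathbb H^2_d}.$$ If $c=\begin{pmatrix} b \\ a \end{pmatrix}$, then $c$ is column-extreme and $\|\boldsymbol c\|_c^2=\|\boldsymbol b\|_b^2$, where $\boldsymbol c=(L^*\otimes I_2)c^{\mathrm t}$ and $\boldsymbol b=L^*b^{\mathrm t}$.
   Context: Fix $d\in\mathbb N\cup\{\infty\}$. $\mathbb F^d$ is the free monoid of words in the letters $1,\dots,d$ with unit the empty word $\emptyset$; $\omega^{\mathrm t}$ is the reversed word. For $\omega=i_1\cdots i_n$ and operators $T_1,\dots,T_d$, $T^\omega:=T_{i_1}\cdots T_{i_n}$, $T^\emptyset:=I$. $\mathbb H^2_d$ (full Fock space) is the Hilbert space of formal power series $h=\sum_\omega\hat h_\omega\mathfrak z^\omega$ in non-commuting variables $\mathfrak z_1,\dots,\mathfrak z_d$ with $\sum|\hat h_\omega|^2<\infty$ and orthonormal basis $\{\mathfrak z^\omega\}$; $1:=\mathfrak z^\emptyset$, $h(0):=\hat h_\emptyset$. Inner products are conjugate-linear in the first argument. $h^{\mathrm t}:=\sum\hat h_\omega\mathfrak z^{\omega^{\mathrm t}}$, $U_{\mathrm t}h:=h^{\mathrm t}$. $L_k$,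 $R_k$ are left and right multiplication by $\mathfrak z_k$. $\mathbb C\{\mathfrak z\}$ is the ring of free polynomials. $\mathbb H^\infty_d$ is the algebra of power series $F$ such that left multiplication $F(L):h\mapsto Fh$ is bounded on $\mathbb H^2_d$; $[\mathbb H^\infty_d]_1$ is its closed unit ball; $F(R):=U_{\mathrm t}F(L)U_{\mathrm t}$ is right multiplication by $F^{\mathrm t}$. $F$ is outer if $F(R)$ has dense range. $b\in[\mathbb H^\infty_d]_1$ is column-extreme (CE) if there is no non-zero $e\in\mathbb H^\infty_d$ such that the column $\begin{pmatrix} b(R) \\ e(R) \end{pmatrix}:\mathbb H^2_d\to\mathbb H^2_d\otimes\mathbb C^2$ is contractive; a contractive column $c\in\mathbb H^\infty_d\otimes\mathbb C^2$ is CE if there is no non-zero $e\in\mathbb H^\infty_d\otimes\mathbb C^2$ with $\begin{pmatrix} c \\ e \end{pmatrix}$ contractive. $\mathscr H^{\mathrm t}(b)$ is $\mathrm{Ran}\sqrt{I-b(R)b(R)^*}$ with the Hilbert norm $\|\cdot\|_b$ making $\sqrt{I-b(R)b(R)^*}$ a co-isometry onto it; similarly $\mathscr H^{\mathrm t}(c)=\mathrm{Ran}\sqrt{I-c(R)c(R)^*}\subseteq\mathbb H^2_d\otimes\mathbb C^2$ with $c(R)=\begin{pmatrix} b(R) \\ a(R) \end{pmatrix}$ and $c^{\mathrm t}=\begin{pmatrix} b^{\mathrm t} \\ a^{\mathrm t} \end{pmatrix}$. These spaces are invariant under $L_k^*$, resp. $L_k^*\otimes I_2$, and contain $L_k^*b^{\mathrm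 t}$, resp. $(L_k^*\otimes I_2)c^{\mathrm t}$; $\|\boldsymbol b\|_b^2=\sum_k\|L_k^*b^{\mathrm t}\|_b^2$ and $\|\boldsymbol c\|_c^2=\sum_k\|(L_k^*\otimes I_2)c^{\mathrm t}\|_c^2$. If $b$ is non-CE then $b^{\mathrm t}\in\mathscr H^{\mathrm t}(b)$. With $X_k:=L_k^*|_{\mathscr H^{\mathrm t}(b)}$, the Sarason function of a non-CE $b$ is the power series $a$ with $a(0)>0$, $a(0)^2=1-|b(0)|^2-\|\boldsymbol b\|_b^2>0$ and $\hat a_\omega=-a(0)\langle b^{\mathrm t},X^\omega b^{\mathrm t}\rangle_b$ for $\omega\ne\emptyset$; it is known that $a\in[\mathbb H^\infty_d]_1$ and that $c$ is contractive. For $T\ge0$ left Toeplitz (i.e. $L_j^*TL_k=\delta_{j,k}T$), an outer $a\in\mathbb H^\infty_d$ is the maximal outer factor of $T$ if $a(R)^*a(R)\le T$ and $h(R)^*h(R)\le a(R)^*a(R)$ for every outer $h\in\mathbb H^\infty_d$ with $h(R)^*h(R)\le T$. *)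

(* Defs.v *)
From mathcomp Require Import all_boot all_order all_algebra.
From mathcomp Require Import all_classical all_reals ereal esum.
From mathcomp Require Export complex.

Set Implicit Arguments.
Unset Strict Implicit.
Unset Printing Implicit Defensive.

Import Order.TTheory GRing.Theory Num.Theory.
Local Open Scope classical_set_scope.
Local Open Scope ring_scope.

(* Conventions.  The Hilbert space with orthonormal basis indexed by [I] is
   l^2(I): its vectors are the functions [f : I -> R[i]] such that [l2 f].  An
   operator is a function on all of [I -> R[i]], of which only the values on
   l^2 vectors matter; hence every condition on operators is restricted to l^2
   vectors. *)

Section Hilbert.
Context {R : realType}.

Definition vec (I : choiceType) := I -> R[i].

Definition sqmod (z : R[i]) : R := complex.Re z ^+ 2 + complex.Im z ^+ 2.

Definition norm2 {I : choiceType} (f : vec I) : \bar R :=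
  (\esum_(i in [set: I]) (sqmod (f i))%:E)%E.

Definition l2 {I : choiceType} (f : vec I) : Prop := (norm2 f < +oo)%E.

(* Sums of absolutely summable families; the value is irrelevant otherwise. *)
Definition rsum {I : choiceType} (g : I -> R) : R :=
  fine (\esum_(i in [set: I]) (Num.max (g i) 0)%:E) -
  fine (\esum_(i in [set: I]) (Num.max (- g i) 0)%:E).

Definition csum {I : choiceType} (f : I -> R[i]) : R[i] :=
  Complex (rsum (fun i => complex.Re (f i))) (rsum (fun i => complex.Im (f i))).

(* Conjugate-linear in the first argument. *)
Definition inner {I : choiceType} (f g : vec I) : R[i] :=
  csum (fun i => conjc (f i) * g i).

Definition op (I J : choiceType) := vec I -> vec J.

Definition bounded {I J : choiceType} (T : op I J) : Prop :=
  exists M : R, forall h, l2 h -> (norm2 (T h) <= (M ^+ 2)%:E * norm2 h)%E.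

Definition contraction {I J : choiceType} (T : op I J) : Prop :=
  forall h, l2 h -> (norm2 (T h) <= norm2 h)%E.

Definition bounded_linear {I J : choiceType} (T : op I J) : Prop :=
  bounded T /\
  forall (z : R[i]) x y, l2 x -> l2 y ->
    T (fun i => z * x i + y i) = (fun j => z * T x j + T y j).

Definition is_adjoint {I J : choiceType} (T : op I J) (S : op J I) : Prop :=
  (forall y, l2 y -> l2 (S y)) /\
  forall x y, l2 x -> l2 y -> inner y (T x) = inner (S y) x.

(* On l^2 vectors, the unique adjoint of a bounded operator. *)
Definition adj {I J : choiceType} (T : op I J) : op J I :=
  xget (fun=> fun=> 0) [set S | is_adjoint T S].

Definition op_le {I : choiceType} (A B : op I I) : Prop :=
  forall h, l2 h -> inner h (A h) <= inner h (B h).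

Definition positive {I : choiceType} (A : op I I) : Prop :=
  forall h, l2 h -> 0 <= inner h (A h).

Definition is_psqrt {I : choiceType} (A S : op I I) : Prop :=
  [/\ bounded_linear S, positive S & forall h, l2 h -> S (S h) = A h].

(* On l^2 vectors, the unique positive square root of a positive bounded
   operator. *)
Definition psqrt {I : choiceType} (A : op I I) : op I I :=
  xget (fun=> fun=> 0) [set S | is_psqrt A S].

(* The operator-range space of D: Ran D, with the Hilbert structure for which
   D is a co-isometry onto it, i.e. D is isometric on (ker D)^perp.
   [dbr_lift D f] is the preimage of f in (ker D)^perp; it is meaningful for f
   in Ran D. *)
Definition is_dbr_lift {I : choiceType} (D : op I I) (f g : vec I) : Prop :=
  [/\ l2 g, D g = f & forall k, l2 k -> D k = (fun=> 0) -> inner k g = 0].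

Definition dbr_lift {I : choiceType} (D : op I I) (f : vec I) : vec I :=
  xget (fun=> 0) [set g | is_dbr_lift D f g].

Definition dbr_op {I J : choiceType} (T : op I J) : op J J :=
  psqrt (fun y => y \- T (adj T y)).

(* Inner product and squared norm of the de Branges-Rovnyak space
   Ran sqrt(I - T T^* ). *)
Definition dbr_inner {I J : choiceType} (T : op I J) (f g : vec J) : R[i] :=
  inner (dbr_lift (dbr_op T) f) (dbr_lift (dbr_op T) g).

Definition dbr_norm2 {I J : choiceType} (T : op I J) (f : vec J) : \bar R :=
  norm2 (dbr_lift (dbr_op T) f).

End Hilbert.
Arguments vec R I : clear implicits.
Arguments op R I J : clear implicits.

(* The letters are 0, ..., n-1 when d = Some n, and all of nat when d = None,
   which stands for d = infinity. *)
Definition in_alphabet (d : option nat) (k : nat) : bool :=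
  if d is Some n then (k < n)%N else true.

Definition letter (d : option nat) : choiceType := {k : nat | in_alphabet d k}.

Definition word (d : option nat) : choiceType := seq (letter d).

Section FreeSeries.
Context {R : realType} {d : option nat}.

(* Formal power series; the full Fock space consists of those with [l2]. *)
Definition series := vec R (word d).

Definition fone : series := fun w => (w == [::])%:R.

Definition zvar (k : letter d) : series := fun w => (w == [:: k])%:R.

Definition transp (h : series) : series := fun w => h (rev w).

Definition lmul (F : series) : op R (word d) (word d) := fun h w =>
  \sum_(i < (size w).+1) F (take i w) * h (drop i w).

Definition L (k : letter d) : op R (word d) (word d) := lmul (zvar k).

(* F(R) = U_t F(L) U_t *)
Definition rmul (F : series) : op R (word d) (word d) :=
  fun h => transp (lmul F (transp h)).

Definition Hinf (F : series) : Prop := bounded (lmul F).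

Definition Hinf_ball (F : series) : Prop := contraction (lmul F).

Definition free_poly (p : series) : Prop := finite_set [set w | p w != 0].

Definition outer (F : series) : Prop :=
  Hinf F /\
  forall (g : series) (eps : R), l2 g -> 0 < eps ->
    exists2 h : series, l2 h & (norm2 (g \- rmul F h)%R < eps%:E)%E.

(* l^2(word * 'I_n) is H^2 (x) C^n, and a column of n series acts into it. *)
Definition column (n : nat) := 'I_n -> series.

Definition cmul {n} (c : column n) : op R (word d) (word d * 'I_n)%type :=
  fun h p => rmul (c p.2) h p.1.

Definition col2 (f g : series) : column 2 := fun i => if i == ord0 then f else g.

Definition stack {m n} (c : column m) (e : column n) : column (m + n) :=
  fun i => match fintype.split i with inl j => c j | inr j => e j end.

Definition ctransp {n} (c : column n) : vec R (word d * 'I_n)%type :=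
  fun p => transp (c p.2) p.1.

(* A (x) I_n *)
Definition ampl n (A : op R (word d) (word d)) :
    op R (word d * 'I_n)%type (word d * 'I_n)%type :=
  fun f p => A (fun w => f (w, p.2)) p.1.

Definition column_extreme (b : series) : Prop :=
  ~ exists e : series,
      [/\ Hinf e, e <> (fun=> 0) & contraction (cmul (col2 b e))].

Definition column_extreme2 (c : column 2) : Prop :=
  [/\ forall j, Hinf (c j), contraction (cmul c) &
   ~ exists e : column 2,
      [/\ forall j, Hinf (e j), e <> (fun=> fun=> 0) &
          contraction (cmul (stack c e))]].

Definition bold_norm2 (b : series) : \bar R :=
  (\esum_(k in [set: letter d]) dbr_norm2 (rmul b) (adj (L k) (transp b)))%E.

Definition cbold_norm2 {n} (c : column n) : \bar R :=
  (\esum_(k in [set: letter d])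
     dbr_norm2 (cmul c) (ampl (adj (L k)) (ctransp c)))%E.

(* X^w h = X_{i_1} (... (X_{i_n} h)) for w = i_1 ... i_n *)
Definition Xpow (w : word d) (h : series) : series :=
  foldr (fun k f => adj (L k) f) h w.

Definition is_sarason (b a : series) : Prop :=
  [/\ 0 < a [::],
      ((complex.Re (a [::]) ^+ 2)%:E =
         1 - (sqmod (b [::]))%:E - bold_norm2 b)%E &
      forall w : word d, w <> [::] ->
        a w = - a [::] * dbr_inner (rmul b) (transp b) (Xpow w (transp b))].

Definition gram (F : series) : op R (word d) (word d) :=
  fun h => adj (rmul F) (rmul F h).

(* I - b(R)^* b(R) *)
Definition toepl (b : series) : op R (word d) (word d) := fun h => h \- gram b h.

Definition left_toeplitz (T : op R (word d) (word d)) : Prop :=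
  forall (j k : letter d) h, l2 h ->
    adj (L j) (T (L k h)) = (if j == k then T h else fun=> 0).

Definition maximal_outer_factor (T : op R (word d) (word d)) (a : series) :
    Prop :=
  [/\ bounded_linear T, positive T & left_toeplitz T] /\
  [/\ outer a, op_le (gram a) T &
      forall h : series, outer h -> op_le (gram h) T ->
        op_le (gram h) (gram a)].

End FreeSeries.
Arguments series R d : clear implicits.

(* Main.v *)
Require Import Defs.
From mathcomp Require Import all_boot all_order all_algebra.
From mathcomp Require Import all_classical all_reals ereal esum.
From HB Require Import structures.
From mathcomp Require Import finmap.
From mathcomp Require Import ring lra.

Set Implicit Arguments.
Unset Strict Implicit.
Unset Printing Implicit Defensive.

Import Order.TTheory GRing.Theory Num.Theory.
Local Open Scope classical_set_scope.
Local Open Scope ring_scope.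
Local Open Scope complex_scope.

(** Write [T'] for the adjoint of an operator [T], [B = b(R)], [D] for the positive
    square root of [1 - B' B], and [K] for the closed range of [D]. As [B] commutes
    with the left shifts [L_k], the operator [D^2 = I - b(R)' b(R)] is left Toeplitz.
    So [D x |-> D (L_k x)] defines isometries [V_k] of [K] with orthogonal ranges,
    and [D V_k' = L_k' D] ([wold], [defect_wold']). Put [v = D 1].

    The range space of [b] is read in the model of pairs [(f, g)] with [g] in [K] and
    [B' f + D g = 0] ([model_pair]): such an [f] lies in the range of the square root
    of [1 - B B'], and inner products there are those of the pairs
    ([dbr_inner_model]). In this model [L_k'] and [V_k'] act together, one on each
    component, as the backward shift.

    If [b] is not column-extreme, an [e] completing it to a contractive column
    satisfies [|e(R) x| <= |D x|], while the coefficient of [e(R) x] at a shortest word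
    is a multiple of [x(0)]. So [D x |-> x(0)] is bounded, and it is represented by
    a vector [u] of [K] with [D u = 1] ([defect_vacuum_root]). Since [K] is the closure
    of the image of the polynomials, [alpha^2 = 1 / |u|^2] is the infimum of
    [<1 - p, D^2 (1 - p)>] over polynomials without constant term ([defect_lower],
    [defect_upper]). The transpose of [b] is [B 1], which corresponds to the pair
    [(B 1, v - u)]; its backward shifts correspond to [(L_k' B 1, V_k' v)] because
    [V_k' u = 0]. Summing squared norms gives [1 - |b(0)|^2 - alpha^2]
    ([esum_dbr_norm2]), so [a(0) = alpha], and the inner products that define the other
    coefficients of the Sarason function collapse to those of [v] with the vectors
    [alpha V^w u] ([sarason_coefficient]).

    These vectors are an orthonormal basis of the shift part in the Wold decomposition
    of [(V_k)]. Hence [a(R)] is [D] followed by the expansion along that basis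
    ([sarason_outer_factor]). This makes [a(R)' a(R) <= D^2] and the density of the
    range of [a(R)] clear. For maximality, if [h(R)' h(R) <= D^2] then [h(R) = F D] with a
    contraction [F] intertwining [V_k] and [L_k]. Such an [F] kills the complement of
    the shift part ([outer_factor_maximal]).

    For the column [c = (b, a)] the squared defect is [D^2 - a(R)' a(R)], whose infimum
    over the same polynomials is [alpha^2 - alpha^2 = 0] ([defect_column_small]). A
    nonzero column completing [c] would make it positive, so [c] is column-extreme. The
    computation of the norm, applied to [c], gives
    [1 - |b(0)|^2 - |a(0)|^2 - 0], the same value as for [b].

    The Hilbert space theory that this needs (adjoints, factorization, square roots) is
    developed first for the concrete spaces of square-summable families. *)

(** * Sums of absolutely summable families *)

Section AbsoluteSums.
Context {R : realType} {I : choiceType}.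
Implicit Types (g h p q : I -> R) (f : I -> R[i]) (z : R[i]).

Definition esumT p : \bar R := (\esum_(i in [set: I]) (p i)%:E)%E.

Definition finsum p := (forall i, 0 <= p i) /\ (esumT p < +oo)%E.

Definition abs_summable g := (esumT (fun i => `|g i|%R) < +oo)%E.

Lemma esumT_ge0 p : (forall i, 0 <= p i) -> (0 <= esumT p)%E.
Proof. by move=> p0; apply: esum_ge0 => i _; rewrite lee_fin. Qed.

Lemma le_esumT p q : (forall i, p i <= q i) -> (esumT p <= esumT q)%E.
Proof. by move=> pq; apply: le_esum => i _; rewrite lee_fin. Qed.

Lemma esumT_le_fin p (c : R) :
  (forall s : seq I, uniq s -> \sum_(i <- s) p i <= c) -> (esumT p <= c%:E)%E.
Proof.
move=> le; apply: ge_ereal_sup => _ [A [finA _] <-].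
by rewrite fsbig_finite//= sumEFin lee_fin; apply: le; exact: fset_uniq.
Qed.

Lemma fin_le_esumT p (s : seq I) : uniq s -> ((\sum_(i <- s) p i)%:E <= esumT p)%E.
Proof.
move=> us; rewrite -sumEFin; apply: esum_ge; exists [set` s].
  by split => //; exact: finite_seq.
by rewrite fsbig_seq.
Qed.

Lemma finsum_fin p : finsum p -> esumT p \is a fin_num.
Proof. by move=> [p0 pfin]; rewrite ge0_fin_numE// esumT_ge0. Qed.

Lemma finsumK p : finsum p -> esumT p = (fine (esumT p))%:E.
Proof. by move=> /finsum_fin ?; rewrite fineK. Qed.

Lemma finsum_le p q : (forall i, 0 <= p i) -> (forall i, p i <= q i) ->
  finsum q -> finsum p.
Proof. by move=> p0 pq [_ q1]; split=> //; apply: le_lt_trans q1; exact: le_esumT. Qed.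

Lemma esumTD p q : (forall i, 0 <= p i) -> (forall i, 0 <= q i) ->
  esumT (fun i => p i + q i) = (esumT p + esumT q)%E.
Proof.
move=> p0 q0; rewrite /esumT -esumD; last 2 first.
- by move=> i _; rewrite lee_fin.
- by move=> i _; rewrite lee_fin.
by apply: eq_esum => i _; rewrite EFinD.
Qed.

Lemma finsumD p q : finsum p -> finsum q -> finsum (fun i => p i + q i).
Proof.
move=> [p0 p1] [q0 q1]; split; first by move=> i; rewrite addr_ge0.
by rewrite esumTD// lte_add_pinfty.
Qed.

Lemma esumTZ (c : R) p : 0 <= c -> (forall i, 0 <= p i) ->
  esumT (fun i => c * p i) = (c%:E * esumT p)%E.
Proof.
move=> c0 p0.
have le (e : R) (r : I -> R) : 0 <= e -> (forall i, 0 <= r i) ->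
    (esumT (fun i => (e * r i)%R) <= e%:E * esumT r)%E.
  move=> e0 r0; apply: ge_ereal_sup => _ [F [finF FT] <-].
  have -> : (\sum_(i \in F) (e * r i)%:E = e%:E * \sum_(i \in F) (r i)%:E)%E.
    rewrite ge0_mule_fsumr; last by move=> i; rewrite lee_fin.
    by apply: eq_fsbigr => i _; rewrite EFinM.
  by apply: lee_wpmul2l; [rewrite lee_fin | apply: ereal_sup_ubound; exists F].
apply/eqP; rewrite eq_le le//=.
have [c1|c1] := eqVneq c 0; [rewrite {}c1 | have {c1}c0 : 0 < c by rewrite lt_neqAle eq_sym c1].
  by rewrite mul0e esumT_ge0// => i; rewrite mul0r.
rewrite -lee_pdivlMl//; apply: le_trans; last first.
  by apply: (le c^-1 (fun i => c * p i)); rewrite ?invr_ge0 ?ltW// => i; rewrite mulr_ge0// ltW.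
by apply: le_esumT => i; rewrite mulKf// gt_eqF.
Qed.

Lemma finsumZ (c : R) p : 0 <= c -> finsum p -> finsum (fun i => c * p i).
Proof.
move=> c0 fp; case: (fp) => p0 p1; split; first by move=> i; rewrite mulr_ge0.
by rewrite esumTZ// (finsumK fp) -EFinM ltry.
Qed.

Lemma finsum_abs g : abs_summable g -> finsum (fun i => `|g i|).
Proof. by move=> ?; split. Qed.

(** Any splitting into nonnegative summable parts computes [rsum], because
    [(p - q)^+ + q = p + (p - q)^-]; linearity of [rsum] follows from this freedom. *)
Lemma rsum_diff p q : finsum p -> finsum q ->
  rsum (fun i => p i - q i) = fine (esumT p) - fine (esumT q).
Proof.
move=> fp fq; rewrite /rsum.
set P := fun i => Num.max (p i - q i) 0; set N := fun i => Num.max (- (p i - q i)) 0.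
have [[p0 _] [q0 _]] := (fp, fq).
have fP : finsum P.
  apply: finsum_le fp => i; rewrite /P ?le_max ?lexx ?orbT//.
  by rewrite ge_max p0 lerBlDr lerDl q0.
have fN : finsum N.
  apply: finsum_le fq => i; rewrite /N ?le_max ?lexx ?orbT//.
  by rewrite ge_max q0 opprB lerBlDr lerDl p0.
rewrite -/(esumT P) -/(esumT N).
have e : esumT (fun i => P i + q i) = esumT (fun i => p i + N i).
  congr esumT; apply/funext => i; rewrite /P /N /Num.max.
  by case: (ltP (p i - q i) 0); case: (ltP (- (p i - q i)) 0) => ? ?; lra.
have [[P0 _] [N0 _]] := (fP, fN).
move: e; rewrite !esumTD//.
rewrite (finsumK fP) (finsumK fN) (finsumK fp) (finsumK fq) /= => -[]; lra.
Qed.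

Lemma rsum_nneg p : (forall i, 0 <= p i) -> rsum p = fine (esumT p).
Proof.
move=> p0; rewrite /rsum.
have -> : (\esum_(i in [set: I]) (Num.max (- p i) 0)%:E)%E = 0%E.
  apply: esum1 => i _; congr (_%:E); apply/max_idPr; by rewrite oppr_le0.
by rewrite /= subr0; congr fine; apply: eq_esum => i _; congr (_%:E); apply/max_idPl.
Qed.

Lemma abs_summable_split g : abs_summable g ->
  exists p q, [/\ finsum p, finsum q & forall i, g i = p i - q i].
Proof.
move=> /finsum_abs fg; exists (fun i => `|g i|), (fun i => `|g i| - g i); split=> //; last first.
  by move=> i; lra.
apply: (@finsum_le _ (fun i => `|g i| + `|g i|)); last exact: finsumD.
- by move=> i; rewrite subr_ge0 ler_norm.
- by move=> i; rewrite lerD2l -normrN ler_norm.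
Qed.

Lemma abs_summableD g h : abs_summable g -> abs_summable h ->
  abs_summable (fun i => g i + h i).
Proof.
move=> /finsum_abs fg /finsum_abs fh.
have [] // := @finsum_le (fun i => `|g i + h i|) _ _ _ (finsumD fg fh).
by move=> i; apply: ler_normD.
Qed.

Lemma abs_summableZ (c : R) g : abs_summable g -> abs_summable (fun i => c * g i).
Proof.
move=> /finsum_abs fg.
have [] // := @finsum_le (fun i => `|c * g i|) _ _ _ (finsumZ (normr_ge0 c) fg).
by move=> i; rewrite normrM.
Qed.

Lemma rsumD g h : abs_summable g -> abs_summable h ->
  rsum (fun i => g i + h i) = rsum g + rsum h.
Proof.
move=> /abs_summable_split[p [q [fp fq e]]] /abs_summable_split[p' [q' [fp' fq' e']]].
rewrite (_ : g = fun i => p i - q i); last exact/funext.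
rewrite (_ : h = fun i => p' i - q' i); last exact/funext.
rewrite !rsum_diff//.
have -> : (fun i => p i - q i + (p' i - q' i)) = fun i => (p i + p' i) - (q i + q' i).
  by apply/funext => i; ring.
rewrite rsum_diff; try exact: finsumD.
have [[p0 _] [q0 _]] := (fp, fq). have [[p0' _] [q0' _]] := (fp', fq').
rewrite !esumTD// (finsumK fp) (finsumK fq) (finsumK fp') (finsumK fq') /=; ring.
Qed.

Lemma rsumZ (c : R) g : abs_summable g -> rsum (fun i => c * g i) = c * rsum g.
Proof.
move=> /abs_summable_split[p [q [fp fq e]]].
rewrite (_ : g = fun i => p i - q i); last exact/funext.
have [[p0 _] [q0 _]] := (fp, fq).
rewrite !rsum_diff//.
have [c0|c0] := leP 0 c.
  have -> : (fun i => c * (p i - q i)) = fun i => c * p i - c * q i.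
    by apply/funext => i; ring.
  rewrite rsum_diff; try exact: finsumZ.
  by rewrite !esumTZ// (finsumK fp) (finsumK fq) /=; ring.
have -> : (fun i => c * (p i - q i)) = fun i => (- c) * q i - (- c) * p i.
  by apply/funext => i; ring.
have c0' : 0 <= - c by lra.
rewrite rsum_diff; try exact: finsumZ.
by rewrite !esumTZ// (finsumK fp) (finsumK fq) /=; ring.
Qed.

Definition csummable f :=
  abs_summable (fun i => complex.Re (f i)) /\ abs_summable (fun i => complex.Im (f i)).

Lemma ReM z w : complex.Re (z * w) =
  complex.Re z * complex.Re w + (- complex.Im z) * complex.Im w.
Proof. by case: z w => [a b] [c e] /=; ring. Qed.

Lemma ImM z w : complex.Im (z * w) =
  complex.Re z * complex.Im w + complex.Im z * complex.Re w.
Proof. by case: z w => [a b] [c e] /=; ring. Qed.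

Lemma csumD f1 f2 : csummable f1 -> csummable f2 ->
  csum (fun i => f1 i + f2 i) = csum f1 + csum f2.
Proof.
move=> [a1 b1] [a2 b2]; rewrite /csum; apply/eqP; rewrite eq_complex /=.
rewrite -rsumD// -rsumD//; apply/andP; split; apply/eqP; congr rsum;
  by apply/funext => i; rewrite raddfD.
Qed.

Lemma csumZ z f : csummable f -> csum (fun i => z * f i) = z * csum f.
Proof.
move=> [a1 b1]; rewrite /csum; apply/eqP; rewrite eq_complex ReM ImM /=.
rewrite -!rsumZ// -!rsumD; try exact: abs_summableZ.
apply/andP; split; apply/eqP; congr rsum; apply/funext => i.
  by rewrite ReM.
by rewrite ImM.
Qed.

Lemma csumJ f : csummable f -> csum (fun i => conjc (f i)) = conjc (csum f).
Proof.
move=> [a1 b1]; rewrite /csum /=.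
congr Complex; first by congr rsum; apply/funext => i; case: (f i).
rewrite -mulN1r -rsumZ//; congr rsum; apply/funext => i; rewrite mulN1r; by case: (f i).
Qed.

End AbsoluteSums.

(** * The Hilbert space of square-summable families *)

Section SquaredModulus.
Context {R : realType}.
Implicit Types z w : R[i].

Lemma complex_ext z w : complex.Re z = complex.Re w -> complex.Im z = complex.Im w -> z = w.
Proof. by case: z w => [a b] [c e] /= -> ->. Qed.

Lemma sqmod_ge0 z : 0 <= sqmod z.
Proof. by rewrite addr_ge0 ?sqr_ge0. Qed.

Lemma sqmodM z w : sqmod (z * w) = sqmod z * sqmod w.
Proof. by rewrite /sqmod ReM ImM; ring. Qed.

Lemma sqmodJ z : sqmod (conjc z) = sqmod z.
Proof. by case: z => a b; rewrite /sqmod /= sqrrN. Qed.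

Lemma sqmodN z : sqmod (- z) = sqmod z.
Proof. by case: z => a b; rewrite /sqmod /= !sqrrN. Qed.

Lemma sqmod0 : sqmod (0 : R[i]) = 0.
Proof. by rewrite /sqmod /= expr0n addr0. Qed.

Lemma sqmod1 : sqmod (1 : R[i]) = 1.
Proof. by rewrite /sqmod /= expr0n addr0 expr1n. Qed.

Lemma sqmodC (x : R) : sqmod x%:C = x ^+ 2.
Proof. by rewrite /sqmod /= expr0n addr0. Qed.

Lemma sqmod_eq0 z : sqmod z = 0 -> z = 0.
Proof.
move=> /eqP; rewrite paddr_eq0 ?sqr_ge0// !sqrf_eq0 => /andP [/eqP a /eqP b].
exact: complex_ext.
Qed.

Lemma mulJc z : conjc z * z = (sqmod z)%:C.
Proof. by apply: complex_ext; rewrite ?ReM ?ImM; case: z => a b; rewrite /sqmod /=; ring. Qed.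

Lemma sqmodD_le z w : sqmod (z + w) <= 2 * (sqmod z + sqmod w).
Proof.
rewrite /sqmod !raddfD /= -subr_ge0.
set a := complex.Re z; set b := complex.Im z; set c := complex.Re w; set e := complex.Im w.
rewrite (_ : _ - _ = (a - c) ^+ 2 + (b - e) ^+ 2); last by ring.
by rewrite addr_ge0 ?sqr_ge0.
Qed.

Lemma conjcM z w : conjc (z * w) = conjc z * conjc w.
Proof. exact: rmorphM. Qed.

Lemma conjcD z w : conjc (z + w) = conjc z + conjc w.
Proof. exact: rmorphD. Qed.

Lemma conjcN z : conjc (- z) = - conjc z.
Proof. exact: rmorphN. Qed.

Lemma ReD z w : complex.Re (z + w) = complex.Re z + complex.Re w.
Proof. by case: z w => [a b] [c e]. Qed.

Lemma ReN z : complex.Re (- z) = - complex.Re z.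
Proof. by case: z. Qed.

Lemma ReJ z : complex.Re (conjc z) = complex.Re z.
Proof. by case: z. Qed.

Lemma Re_sq_le z : complex.Re z ^+ 2 <= sqmod z.
Proof. by rewrite lerDl sqr_ge0. Qed.

End SquaredModulus.

Section HilbertType.
Context {R : realType}.

(** Carrying square-summability with the vector makes it a module, so that
    operators become plain functions and no side condition is left in equations. *)
Record l2vec (I : choiceType) := L2Vec { l2val :> I -> R[i] ; l2valP : @l2 R I l2val }.

HB.instance Definition _ (I : choiceType) := gen_eqMixin (l2vec I).
HB.instance Definition _ (I : choiceType) := gen_choiceMixin (l2vec I).

Lemma norm2E I (f : vec R I) : norm2 f = esumT (fun i => sqmod (f i)).
Proof. by []. Qed.

Lemma l2_finsum I (f : vec R I) : l2 f -> finsum (fun i => sqmod (f i)).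
Proof. by move=> lf; split=> // i; exact: sqmod_ge0. Qed.

Lemma l2_le I (f : vec R I) (p : I -> R) : (forall i, sqmod (f i) <= p i) -> finsum p -> l2 f.
Proof. by move=> le fp; have [] := finsum_le (fun i => sqmod_ge0 (f i)) le fp. Qed.

Lemma l2D I (f g : vec R I) : l2 f -> l2 g -> l2 (fun i => f i + g i).
Proof.
move=> /l2_finsum ff /l2_finsum fg.
apply: (l2_le (fun i => sqmodD_le (f i) (g i))).
by apply: (@finsumZ _ _ 2) => //; exact: finsumD.
Qed.

Lemma l2Z I (z : R[i]) (f : vec R I) : l2 f -> l2 (fun i => z * f i).
Proof.
move=> /l2_finsum ff; apply: (@l2_le _ _ (fun i => sqmod z * sqmod (f i))).
  by move=> i; rewrite sqmodM.
by apply: finsumZ => //; exact: sqmod_ge0.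
Qed.

Lemma l2N I (f : vec R I) : l2 f -> l2 (fun i => - f i).
Proof.
by move=> /l2_finsum ff; apply: (l2_le _ ff) => i; rewrite sqmodN.
Qed.

Lemma l20 (I : choiceType) : l2 (fun _ : I => 0 : R[i]).
Proof.
by rewrite /l2 norm2E /esumT esum1// => i _; rewrite sqmod0.
Qed.

Section One.
Context {I : choiceType}.
Implicit Types x y z : l2vec I.

Lemma l2vec_ext x y : (forall i, x i = y i) -> x = y.
Proof.
case: x y => [f lf] [g lg] /= /funext e; subst g; congr L2Vec; exact: Prop_irrelevance.
Qed.

Definition l2vec0 := L2Vec (@l20 I).
Definition l2vec_opp x := L2Vec (l2N (l2valP x)).
Definition l2vec_add x y := L2Vec (l2D (l2valP x) (l2valP y)).
Definition l2vec_scale (a : R[i]) x := L2Vec (l2Z a (l2valP x)).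

Let addA : associative l2vec_add.
Proof. by move=> x y z; apply: l2vec_ext => i /=; rewrite addrA. Qed.
Let addC : commutative l2vec_add.
Proof. by move=> x y; apply: l2vec_ext => i /=; rewrite addrC. Qed.
Let add0 : left_id l2vec0 l2vec_add.
Proof. by move=> x; apply: l2vec_ext => i /=; rewrite add0r. Qed.
Let addN : left_inverse l2vec0 l2vec_opp l2vec_add.
Proof. by move=> x; apply: l2vec_ext => i /=; rewrite addNr. Qed.

HB.instance Definition _ := GRing.isZmodule.Build (l2vec I) addA addC add0 addN.

Let scaleA a b x : l2vec_scale a (l2vec_scale b x) = l2vec_scale (a * b) x.
Proof. by apply: l2vec_ext => i /=; rewrite mulrA. Qed.
Let scale1 : left_id 1 l2vec_scale.
Proof. by move=> x; apply: l2vec_ext => i /=; rewrite mul1r. Qed.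
Let scaleDr : right_distributive l2vec_scale +%R.
Proof. by move=> a x y; apply: l2vec_ext => i /=; rewrite mulrDr. Qed.
Let scaleDl x : {morph l2vec_scale^~ x : a b / a + b}.
Proof. by move=> a b; apply: l2vec_ext => i /=; rewrite mulrDl. Qed.

HB.instance Definition _ :=
  GRing.Zmodule_isLmodule.Build R[i] (l2vec I) scaleA scale1 scaleDr scaleDl.

Lemma l2valD x y i : (x + y) i = x i + y i. Proof. by []. Qed.
Lemma l2valZ a x i : (a *: x) i = a * x i. Proof. by []. Qed.
Lemma l2valN x i : (- x) i = - x i. Proof. by []. Qed.

Definition nsq x : R := fine (norm2 x).

Definition dot x y : R[i] := locked (inner x y).

Lemma dotE x y : dot x y = inner x y.
Proof. by rewrite /dot -lock. Qed.

Arguments nsq : simpl never.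

Lemma norm2_nsq x : norm2 x = (nsq x)%:E.
Proof. exact: finsumK (l2_finsum (l2valP x)). Qed.

Lemma nsq_ge0 x : 0 <= nsq x.
Proof. by rewrite -lee_fin -norm2_nsq; apply: esumT_ge0 => i; exact: sqmod_ge0. Qed.

Let dot_summable x y : csummable (fun i => conjc (x i) * y i).
Proof.
have fin := finsumD (l2_finsum (l2valP x)) (l2_finsum (l2valP y)).
have bound (a b c e : R) : `|a * b + c * e| <= a ^+ 2 + c ^+ 2 + (b ^+ 2 + e ^+ 2).
  rewrite ler_norml; apply/andP; split; rewrite -subr_ge0.
    have := addr_ge0 (sqr_ge0 (a + b)) (sqr_ge0 (c + e)).
    have := addr_ge0 (addr_ge0 (sqr_ge0 a) (sqr_ge0 b)) (addr_ge0 (sqr_ge0 c) (sqr_ge0 e)).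
    lra.
  have := addr_ge0 (sqr_ge0 (a - b)) (sqr_ge0 (c - e)).
  have := addr_ge0 (addr_ge0 (sqr_ge0 a) (sqr_ge0 b)) (addr_ge0 (sqr_ge0 c) (sqr_ge0 e)).
  lra.
split.
  have [] // := @finsum_le _ _ (fun i => `|complex.Re (conjc (x i) * y i)|) _ _ _ fin.
  move=> i; rewrite ReM; apply: le_trans (bound _ _ _ _) _.
  by case: (x i) (y i) => [a b] [c e]; rewrite /sqmod /= opprK.
have [] // := @finsum_le _ _ (fun i => `|complex.Im (conjc (x i) * y i)|) _ _ _ fin.
move=> i; rewrite ImM; apply: le_trans (bound _ _ _ _) _.
by case: (x i) (y i) => [a b] [c e]; rewrite /sqmod /= sqrrN [e ^+ 2 + _]addrC.
Qed.

Lemma dotDr x y z : dot x (y + z) = dot x y + dot x z.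
Proof.
rewrite !dotE /inner -csumD//; congr csum; apply/funext => i /=.
by rewrite mulrDr.
Qed.

Lemma dotZr a x y : dot x (a *: y) = a * dot x y.
Proof.
rewrite !dotE /inner -csumZ//; congr csum; apply/funext => i /=.
by rewrite mulrCA.
Qed.

Lemma dotJ x y : conjc (dot x y) = dot y x.
Proof.
rewrite !dotE /inner -csumJ//; congr csum; apply/funext => i.
by rewrite conjcM conjcK mulrC.
Qed.

Lemma dotDl x y z : dot (x + y) z = dot x z + dot y z.
Proof. by rewrite -dotJ dotDr conjcD !dotJ. Qed.

Lemma dotZl a x y : dot (a *: x) y = conjc a * dot x y.
Proof. by rewrite -dotJ dotZr conjcM dotJ. Qed.

Lemma dotNr x y : dot x (- y) = - dot x y.
Proof. by rewrite -scaleN1r dotZr mulN1r. Qed.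

Lemma dot0r x : dot x 0 = 0.
Proof. by rewrite -(scale0r 0) dotZr mul0r. Qed.

Lemma dot0l x : dot 0 x = 0.
Proof. by rewrite -dotJ dot0r conjc0. Qed.

Lemma dotNl x y : dot (- x) y = - dot x y.
Proof. by rewrite -dotJ dotNr conjcN dotJ. Qed.

Lemma dotBr x y z : dot x (y - z) = dot x y - dot x z.
Proof. by rewrite dotDr dotNr. Qed.

Lemma dotBl x y z : dot (x - y) z = dot x z - dot y z.
Proof. by rewrite dotDl dotNl. Qed.

Lemma dot_sumr (K : Type) (t : seq K) (f : K -> l2vec I) x :
  dot x (\sum_(k <- t) f k) = \sum_(k <- t) dot x (f k).
Proof.
elim: t => [|k t IH]; first by rewrite !big_nil dot0r.
by rewrite !big_cons dotDr IH.
Qed.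

Lemma dotxx x : dot x x = (nsq x)%:C.
Proof.
have e : (fun i => conjc (x i) * x i) = fun i => (sqmod (x i))%:C.
  by apply/funext => i; rewrite mulJc.
rewrite !dotE /inner e; apply: complex_ext; rewrite /csum [LHS]/=.
  by rewrite rsum_nneg// => i; exact: sqmod_ge0.
by rewrite rsum_nneg// /esumT esum1.
Qed.

Lemma nsqE x : nsq x = complex.Re (dot x x).
Proof. by rewrite dotxx. Qed.

Lemma nsqD x y : nsq (x + y) = nsq x + nsq y + 2 * complex.Re (dot x y).
Proof.
rewrite !nsqE dotDl !dotDr -(dotJ x y) !ReD ReJ; ring.
Qed.

Lemma nsqN x : nsq (- x) = nsq x.
Proof. by rewrite !nsqE dotNl dotNr opprK. Qed.

Lemma nsqB x y : nsq (x - y) = nsq x + nsq y - 2 * complex.Re (dot x y).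
Proof. by rewrite nsqD nsqN dotNr ReN mulrN. Qed.

Lemma nsqZ a x : nsq (a *: x) = sqmod a * nsq x.
Proof. by rewrite !nsqE dotZl dotZr mulrA mulJc dotxx -rmorphM. Qed.

Lemma nsq0 : nsq 0 = 0.
Proof. by rewrite nsqE dot0r. Qed.

Lemma sqmod_coord_le x i : sqmod (x i) <= nsq x.
Proof.
rewrite -lee_fin -norm2_nsq; apply: esum_ge; exists [set i]; first by split.
by rewrite fsbig_set1.
Qed.

Lemma nsq_eq0 x : nsq x = 0 -> x = 0.
Proof.
move=> x0; apply: l2vec_ext => i; apply: sqmod_eq0; apply/eqP.
by rewrite eq_le sqmod_ge0 andbT -x0 sqmod_coord_le.
Qed.

Lemma nsqD_le x y : nsq (x + y) <= 2 * (nsq x + nsq y).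
Proof. have := nsq_ge0 (x - y); rewrite nsqB nsqD; lra. Qed.

Lemma nsqBC x y : nsq (x - y) = nsq (y - x).
Proof. by rewrite -nsqN opprB. Qed.

Lemma CauchySchwarz x y : sqmod (dot x y) <= nsq x * nsq y.
Proof.
have [/nsq_eq0 ->|x0] := eqVneq (nsq x) 0.
  by rewrite dot0l sqmod0 nsq0 mul0r.
have xp : 0 < nsq x by rewrite lt_neqAle eq_sym x0 nsq_ge0.
have e : complex.Re (dot ((nsq x)%:C *: y) (dot x y *: x)) = nsq x * sqmod (dot x y).
  by rewrite dotZl dotZr conjc_real -(dotJ x y) [_ * conjc _]mulrC mulJc -rmorphM.
(* [|x|^2 y - <x, y> x] is a multiple of the component of [y] orthogonal to [x]. *)
have := nsq_ge0 ((nsq x)%:C *: y - dot x y *: x).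
rewrite nsqB e !nsqZ sqmodC.
rewrite (_ : _ - _ = nsq x * (nsq x * nsq y - sqmod (dot x y))); last by ring.
by rewrite pmulr_rge0// subr_ge0.
Qed.

Definition basis_fun (i : I) : vec R I := fun j => (j == i)%:R.

Lemma l2_fsupp (f : vec R I) : finite_set [set i | f i != 0] -> l2 f.
Proof.
move=> fin; rewrite /l2 /norm2 esum_mkcond.
set A := [set i | f i != 0] in fin *.
rewrite (_ : \esum_(i in _) _ = \esum_(i in A) (sqmod (f i))%:E)%E; last first.
  rewrite [RHS]esum_mkcond; apply: eq_esum => i _; rewrite in_setT.
  case: ifPn => //; rewrite notin_setE /A /= => /negP; rewrite negbK => /eqP ->.
  by rewrite sqmod0.
rewrite esum_fset//; last by move=> i _; rewrite lee_fin sqmod_ge0.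
by rewrite fsbig_finite//= sumEFin ltry.
Qed.

Lemma basis_l2 i : l2 (basis_fun i).
Proof.
apply: l2_fsupp; apply: (@sub_finite_set _ _ [set i]) => //.
by move=> j; rewrite /basis_fun /=; case: (j =P i) => // _; rewrite eqxx.
Qed.

Definition basis_vec i : l2vec I := L2Vec (basis_l2 i).

Lemma basis_vecE i j : basis_vec i j = (j == i)%:R. Proof. by []. Qed.

Lemma rsum_single (g : I -> R) i : (forall j, j != i -> g j = 0) -> rsum g = g i.
Proof.
move=> g0.
have e (h : I -> R) : (forall j, 0 <= h j) -> (forall j, j != i -> h j = 0) ->
    fine (esumT h) = h i.
  move=> h0 hi; rewrite /esumT esum_mkcond.
  rewrite (_ : \esum_(j in _) _ = \esum_(j in [set i]) (h j)%:E)%E.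
    by rewrite esum_set1// lee_fin.
  rewrite [RHS]esum_mkcond; apply: eq_esum => j _; rewrite in_setT.
  by case: ifPn => //; rewrite notin_setE /= => /eqP ji; rewrite hi.
rewrite /rsum -/(esumT (fun j => Num.max (g j) 0)) -/(esumT (fun j => Num.max (- g j) 0)).
rewrite !e.
- by rewrite /Num.max; case: (ltP (g i) 0); case: (ltP (- g i) 0) => ? ?; lra.
- by move=> j; rewrite le_max lexx orbT.
- by move=> j /g0 ->; rewrite oppr0 maxxx.
- by move=> j; rewrite le_max lexx orbT.
- by move=> j /g0 ->; rewrite maxxx.
Qed.

Lemma dot_delta i x : dot (basis_vec i) x = x i.
Proof.
have e j : j != i -> conjc (basis_vec i j) * x j = 0.
  by move=> /negbTE ji; rewrite basis_vecE ji conjc0 mul0r.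
rewrite !dotE /inner /csum !(@rsum_single _ i).
- by rewrite basis_vecE eqxx conjc1 mul1r; case: (x i).
- by move=> j /e ->.
- by move=> j /e ->.
Qed.

Lemma dot_deltar i x : dot x (basis_vec i) = conjc (x i).
Proof. by rewrite -dotJ dot_delta. Qed.

Lemma dot_ext x y : (forall z, dot z x = dot z y) -> x = y.
Proof. by move=> e; apply: l2vec_ext => i; rewrite -!dot_delta. Qed.

Lemma dot_extl x y : (forall z, dot x z = dot y z) -> x = y.
Proof. by move=> e; apply: dot_ext => z; rewrite -dotJ e dotJ. Qed.

End One.
End HilbertType.
Arguments l2vec R I : clear implicits.

(** ** Completeness *)

Section Completeness.
Context {R : realType} {I : choiceType}.
Implicit Types (x y z : l2vec R I) (u : nat -> l2vec R I).

Lemma norm2_le_fin (f : vec R I) (c : R) :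
  (forall s : seq I, uniq s -> \sum_(i <- s) sqmod (f i) <= c) -> (norm2 f <= c%:E)%E.
Proof. exact: esumT_le_fin. Qed.

Lemma fin_le_nsq x (s : seq I) : uniq s -> \sum_(i <- s) sqmod (x i) <= nsq x.
Proof. by move=> us; rewrite -lee_fin -norm2_nsq; exact: fin_le_esumT. Qed.

Definition hlim u x := forall e : R, 0 < e ->
  exists N, forall n, (N <= n)%N -> nsq (u n - x) < e.

Definition hcauchy u := forall e : R, 0 < e ->
  exists N, forall m n, (N <= m)%N -> (N <= n)%N -> nsq (u m - u n) < e.

(** The limit is the lower limit, a supremum. *)
Lemma real_cauchy_limit (r : nat -> R) :
  (forall e, 0 < e -> exists N, forall m n, (N <= m)%N -> (N <= n)%N -> (r m - r n) ^+ 2 < e) ->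
  exists l, forall e, 0 < e -> exists N, forall n, (N <= n)%N -> (r n - l) ^+ 2 < e.
Proof.
move=> cau.
pose A : set R := [set a | exists N, forall n, (N <= n)%N -> a <= r n].
have near e : 0 < e -> exists N, forall m n, (N <= m)%N -> (N <= n)%N -> `|r m - r n| < e.
  move=> e0; have [N HN] := cau (e ^+ 2) (exprn_gt0 _ e0).
  exists N => m n Nm Nn; rewrite -(ltr_pXn2r (n := 2))// ?nnegrE ?normr_ge0 ?ltW//.
  by rewrite real_normK ?num_real//; exact: HN.
have lowA e N : (forall m n, (N <= m)%N -> (N <= n)%N -> `|r m - r n| < e) -> A (r N - e).
  move=> HN; exists N => n Nn; have := HN N n (leqnn _) Nn.
  by rewrite ltr_norml => /andP [_]; lra.
have ubA e N : (forall m n, (N <= m)%N -> (N <= n)%N -> `|r m - r n| < e) ->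
    ubound A (r N + e).
  move=> HN a [M HM]; apply: le_trans (HM (maxn M N) (leq_maxl _ _)) _.
  have := HN (maxn M N) N (leq_maxr _ _) (leqnn _).
  by rewrite ltr_norml => /andP [_]; lra.
have supA : has_sup A.
  by have [N HN] := near 1 ltr01; split; [exists (r N - 1); exact: lowA|exists (r N + 1); exact: ubA].
exists (sup A) => e e0.
pose d := Num.min 1 (e / 5).
have d0 : 0 < d by rewrite /d lt_min ltr01 divr_gt0.
have [d1 d2] : d <= 1 /\ d <= e / 5 by rewrite /d !ge_min !lexx orbT.
have [N HN] := near d d0; exists N => n Nn.
have l1 : r N - d <= sup A by apply: ub_le_sup; [exact: supA.2|exact: lowA].
have l2 : sup A <= r N + d by apply: ge_sup; [exact: supA.1|exact: ubA].
have := HN n N Nn (leqnn _); rewrite ltr_norml => /andP [l3 l4].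
nra.
Qed.

(** The limit is taken coordinatewise; the Cauchy condition bounds every finite
    partial sum of the distance to it, hence the distance. *)
Lemma l2vec_complete u : hcauchy u -> exists x, hlim u x.
Proof.
move=> cau.
have coord i : exists l : R[i], forall e, 0 < e ->
    exists N, forall n, (N <= n)%N -> sqmod (u n i - l) < e.
  have [|a Ha] := @real_cauchy_limit (fun n => complex.Re (u n i)).
    move=> e /cau [N HN]; exists N => m n Nm Nn.
    apply: le_lt_trans (HN _ _ Nm Nn); apply: le_trans (sqmod_coord_le _ i).
    by rewrite -ReN -ReD; exact: Re_sq_le.
  have [|b Hb] := @real_cauchy_limit (fun n => complex.Im (u n i)).
    move=> e /cau [N HN]; exists N => m n Nm Nn.
    apply: le_lt_trans (HN _ _ Nm Nn); apply: le_trans (sqmod_coord_le _ i).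
    by rewrite /sqmod !l2valD !l2valN; case: (u m i) (u n i) => [? ?] [? ?] /=; rewrite lerDr sqr_ge0.
  exists (Complex a b) => e e0; have e2 : 0 < e / 2 by rewrite divr_gt0.
  have [[N HN] [M HM]] := (Ha _ e2, Hb _ e2).
  exists (maxn N M) => n; rewrite geq_max => /andP [/HN + /HM].
  by rewrite /sqmod; case: (u n i) => c f /=; lra.
have [x Hx] := choice coord.
have finlim (s : seq I) e : 0 < e -> exists N, forall n, (N <= n)%N ->
    \sum_(i <- s) sqmod (u n i - x i) < e.
  elim: s e => [|i s IH] e e0; first by exists 0 => n _; rewrite big_nil.
  have e2 : 0 < e / 2 by rewrite divr_gt0.
  have [[N HN] [M HM]] := (IH _ e2, Hx i _ e2).
  exists (maxn N M) => n; rewrite geq_max big_cons => /andP [/HN + /HM]; lra.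
have bound e N : 0 < e ->
    (forall m n, (N <= m)%N -> (N <= n)%N -> nsq (u m - u n) < e) ->
    forall n, (N <= n)%N -> (norm2 (fun i => (u n i - x i)%R) <= (4 * e)%:E)%E.
  move=> e0 HN n Nn; apply: norm2_le_fin => s us.
  have [M HM] := finlim s e e0.
  have := HM (maxn N M) (leq_maxr _ _).
  have := le_lt_trans (fin_le_nsq (u n - u (maxn N M)) us) (HN n (maxn N M) Nn (leq_maxl _ _)).
  have : \sum_(i <- s) sqmod (u n i - x i) <=
      2 * (\sum_(i <- s) sqmod ((u n - u (maxn N M)) i) +
           \sum_(i <- s) sqmod (u (maxn N M) i - x i)).
    rewrite -big_split mulr_sumr; apply: ler_sum => i _.
    by apply: le_trans (sqmodD_le _ _); rewrite l2valD l2valN addrA subrK.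
  lra.
have lx : l2 x.
  have [N HN] := cau 1 ltr01.
  have lN : @l2 R I (fun i => u N i - x i).
    by apply: le_lt_trans (bound 1 N ltr01 HN N (leqnn _)) _; rewrite ltry.
  rewrite (_ : x = fun i => u N i + - (u N i - x i)).
    exact: l2D (l2valP _) (l2N lN).
  by apply/funext => i; rewrite opprB addrC subrK.
exists (L2Vec lx) => e e0.
have e5 : 0 < e / 5 by rewrite divr_gt0.
have [N HN] := cau _ e5; exists N => n Nn.
have := bound _ _ e5 HN n Nn.
rewrite (norm2_nsq (u n - L2Vec lx)) lee_fin; lra.
Qed.

Lemma hlim_unique u x y : hlim u x -> hlim u y -> x = y.
Proof.
move=> ux uy; apply/eqP; rewrite -subr_eq0; apply/eqP/nsq_eq0/eqP.
rewrite eq_le nsq_ge0 andbT leNgt; apply/negP => lt0.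
have e0 : 0 < nsq (x - y) / 4 by rewrite divr_gt0.
have [[N HN] [M HM]] := (ux _ e0, uy _ e0).
have := HN (maxn N M) (leq_maxl _ _); have := HM (maxn N M) (leq_maxr _ _).
have := nsqD_le (x - u (maxn N M)) (u (maxn N M) - y).
rewrite addrA subrK (nsqBC x (u _)); lra.
Qed.

Lemma hlimD u v x y : hlim u x -> hlim v y -> hlim (fun n => u n + v n) (x + y).
Proof.
move=> ux vy e e0; have e4 : 0 < e / 4 by rewrite divr_gt0.
have [[N HN] [M HM]] := (ux _ e4, vy _ e4).
exists (maxn N M) => n; rewrite geq_max => /andP [/HN h1 /HM h2].
have := nsqD_le (u n - x) (v n - y); rewrite opprD addrACA; lra.
Qed.

Lemma hlimZ a u x : hlim u x -> hlim (fun n => a *: u n) (a *: x).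
Proof.
move=> ux e e0; have a0 := sqmod_ge0 a.
have p : 0 < sqmod a + 1 by lra.
have [N HN] := ux _ (divr_gt0 e0 p).
exists N => n /HN; rewrite -scalerBr nsqZ => h.
have := nsq_ge0 (u n - x); move: h; rewrite ltr_pdivlMr//; nra.
Qed.

Lemma hlim_cst x : hlim (fun=> x) x.
Proof. by move=> e e0; exists 0%N => n _; rewrite subrr nsq0. Qed.

Lemma hlim_dot_small u x y : hlim u x -> forall e : R, 0 < e ->
  exists N, forall n, (N <= n)%N -> sqmod (dot y (u n) - dot y x) < e.
Proof.
move=> ux e e0; have y0 := nsq_ge0 y.
have p : 0 < nsq y + 1 by lra.
have [N HN] := ux _ (divr_gt0 e0 p).
exists N => n /HN h; rewrite -dotBr; apply: le_lt_trans (CauchySchwarz _ _) _.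
have := nsq_ge0 (u n - x); move: h; rewrite ltr_pdivlMr//; nra.
Qed.

Lemma hlim_nsq_le u x (c : R) : hlim u x -> (forall n, nsq (u n) <= c) -> nsq x <= c.
Proof.
move=> ux uc; rewrite leNgt; apply/negP => cx.
have x0 := nsq_ge0 x.
have c0 : 0 <= c by apply: le_trans (uc 0%N); exact: nsq_ge0.
have xp : 0 < nsq x by lra.
pose e := (nsq x - c) / 2.
have e0 : 0 < e by rewrite /e; lra.
have ee : 0 < e ^+ 2 by rewrite exprn_gt0.
have [N HN] := hlim_dot_small x ux ee.
have := HN N (leqnn _); have := CauchySchwarz x (u N); have := uc N.
rewrite dotxx.
have := Re_sq_le (dot x (u N)).
have := Re_sq_le (dot x (u N) - (nsq x)%:C).
rewrite ReD ReN /=.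
set r := complex.Re (dot x (u N)); set m := nsq (u N) => h1 h2 h3 h4 h5.
have h6 : (r - nsq x) ^+ 2 < e ^+ 2 by lra.
have h7 : r ^+ 2 <= nsq x * c by nra.
have h8 : nsq x - r < e by have : ~ (e <= nsq x - r) by [nra]; lra.
have h9 : r > (nsq x + c) / 2 by rewrite /e in h8; lra.
nra.
Qed.

End Completeness.

(** ** The representation theorem *)

Section Riesz.
Context {R : realType} {I J : choiceType}.
(* With [D] the identity this is the Riesz theorem. A general [D] gives the
   representing vector in the closure of [D dom], which is used both for
   factorizations and to approximate a vector by images of polynomials. *)
Variables (dom : l2vec R I -> Prop) (D : l2vec R I -> l2vec R J) (phi : l2vec R I -> R[i]) (c : R).
Hypothesis dom0 : dom 0.
Hypothesis domP : forall a x y, dom x -> dom y -> dom (a *: x + y).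
Hypothesis Dlin : forall a x y, D (a *: x + y) = a *: D x + D y.
Hypothesis philin : forall a x y, phi (a *: x + y) = a * phi x + phi y.
Hypothesis c0 : 0 <= c.
Hypothesis phi_le : forall x, dom x -> sqmod (phi x) <= c * nsq (D x).

(* Up to a constant, the squared distance from [D x] to the vector representing [phi]. *)
Let F x := nsq (D x) - 2 * complex.Re (phi x).

Let amgm (r n : R) : 0 <= n -> r ^+ 2 <= c * n -> 2 * r <= c + n.
Proof.
move=> n0 h; rewrite leNgt; apply/negP => lt; have h1 := sqr_ge0 (c - n).
have c0' := c0.
have h2 : 0 < (2 * r - (c + n)) * (2 * r + (c + n)) by rewrite mulr_gt0//; lra.
nra.
Qed.

Let phi_amgm x : dom x -> 2 * complex.Re (phi x) <= c + nsq (D x).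
Proof.
move=> dx; apply: amgm; first exact: nsq_ge0.
exact: le_trans (Re_sq_le _) (phi_le dx).
Qed.

Let F_inf : exists m, (forall x, dom x -> m <= F x) /\
  forall e, 0 < e -> exists2 x, dom x & F x < m + e.
Proof.
have hi : has_inf [set F x | x in [set x | dom x]].
  split; first by exists (F 0); exists 0.
  by exists (- c) => _ [x dx <-]; have := phi_amgm dx; rewrite /F; lra.
exists (inf [set F x | x in [set x | dom x]]); split.
  by move=> x dx; apply: ge_inf; [exact: hi.2|exists x].
by move=> e /(inf_adherent)/(_ hi) [_ [x dx <-] lt]; exists x.
Qed.

(** [g] is the limit of [D x_n] along a minimizing sequence of [F]: the
    parallelogram law makes it a Cauchy sequence, and the first variation of [F]
    vanishes in the limit. *)
Lemma riesz_minimum : exists g : l2vec R J,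
  [/\ forall x, dom x -> dot g (D x) = phi x,
      forall e, 0 < e -> exists2 x, dom x & nsq (g - D x) < e &
      nsq g <= c].
Proof.
have [m [Fm approx]] := F_inf.
have c0' := c0.
have [q [e1 archim]] : exists q : nat -> R, (forall n, 0 < q n) /\
    forall e, 0 < e -> exists N, forall n, (N <= n)%N -> q n < e.
  exists (fun n => n.+1%:R^-1); split=> [n|e e0]; first by rewrite invr_gt0 ltr0n.
  exists (Num.truncn e^-1) => n Nn.
  rewrite invf_plt ?posrE ?ltr0n//.
  by apply: lt_le_trans (truncnS_gt _) _; rewrite ler_nat ltnS.
have : forall n, exists x, dom x /\ F x < m + q n.
  by move=> n; have [x] := approx _ (e1 n); exists x.
move=> /choice [xs Hxs].
have Dscale a x : D (a *: x) = a *: D x.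
  have D0 : D 0 = 0.
    have := Dlin 1 0 0; rewrite !scale1r addr0 => h.
    by apply: (addrI (D 0)); rewrite -h addr0.
  by rewrite -[a *: x]addr0 Dlin D0 addr0.
have phiscale a x : phi (a *: x) = a * phi x.
  have phi0 : phi 0 = 0.
    have := philin 1 0 0; rewrite scale1r mul1r addr0 => h.
    by apply: (addrI (phi 0)); rewrite -h addr0.
  by rewrite -[a *: x]addr0 philin phi0 addr0.
have domZ a x : dom x -> dom (a *: x) by move=> dx; rewrite -[_ *: _]addr0; exact: domP.
(* The midpoint of two almost minimizers is no better than the infimum, and the
   parallelogram law turns this into a bound on their distance. *)
have par x y e f : dom x -> dom y -> F x < m + e -> F y < m + f ->
    nsq (D x - D y) < 2 * (e + f).
  move=> dx dy Fx Fy.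
  pose h : R[i] := (2^-1)%:C.
  have := Fm (h *: x + h *: y) (domP _ dx (domZ _ _ dy)).
  rewrite /F Dlin philin Dscale phiscale -scalerDr -mulrDr nsqZ ReM /= sqmodC ReD (nsqD (D x) (D y)).
  by move: Fx Fy; rewrite /F nsqB; lra.
have [g Hg] : exists g, hlim (fun n => D (xs n)) g.
  apply: l2vec_complete => e e0; have e4 : 0 < e / 4 by rewrite divr_gt0.
  have [N HN] := archim _ e4; exists N => i j Ni Nj.
  have [[d1 F1] [d2 F2]] := (Hxs i, Hxs j).
  have := par _ _ _ _ d1 d2 F1 F2; have := HN _ Ni; have := HN _ Nj; lra.
have clos e : 0 < e -> exists2 x, dom x & nsq (g - D x) < e.
  move=> e0; have [N HN] := Hg _ e0; exists (xs N); first by case: (Hxs N).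
  by rewrite nsqBC; exact: HN.
(* [F (x + t y)] is at least the infimum for every complex [t]; the best [t] is
   [- conj d / |D y|^2]. *)
have var x y e : dom x -> dom y -> F x < m + e -> 0 < e ->
    sqmod (dot (D x) (D y) - phi y) <= e * nsq (D y).
  move=> dx dy Fx e0; set d := dot _ _ - _.
  have tvar t : 0 <= e + 2 * complex.Re (t * d) + sqmod t * nsq (D y).
    have := Fm (t *: y + x) (domP _ dy dx).
    rewrite /F Dlin philin nsqD nsqZ dotZl ReD -(dotJ (D x)) -conjcM ReJ.
    move: Fx; rewrite /F /d mulrBr ReD ReN; lra.
  have dy0 := nsq_ge0 (D y).
  have [y0|y0] := eqVneq (nsq (D y)) 0.
    have py : phi y = 0.
      apply: sqmod_eq0; apply/eqP; rewrite eq_le sqmod_ge0 andbT.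
      by have := phi_le dy; rewrite y0 mulr0.
    by rewrite /d py (nsq_eq0 y0) dot0r subr0 sqmod0 nsq0 mulr0.
  have yp : 0 < nsq (D y) by rewrite lt_neqAle eq_sym y0.
  have := tvar ((- (nsq (D y))^-1)%:C * conjc d).
  rewrite -mulrA mulJc -rmorphM /= sqmodM sqmodJ sqmodC sqrrN.
  set n := nsq (D y) in yp y0 *; set s := sqmod d.
  rewrite (_ : _ + _ = (e * n - s) / n); last by field.
  by rewrite divr_ge0_gt0 // || (rewrite pmulr_lge0 ?invr_gt0// subr_ge0).
have gphi y : dom y -> dot g (D y) = phi y.
  move=> dy; apply/eqP; rewrite -subr_eq0; apply/eqP/sqmod_eq0/eqP.
  rewrite eq_le sqmod_ge0 andbT leNgt; apply/negP => lt0.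
  set s := sqmod _ in lt0.
  have dy0 := nsq_ge0 (D y).
  have p : 0 < 8 * (nsq (D y) + 1) by lra.
  have e0 : 0 < s / (8 * (nsq (D y) + 1)) by rewrite divr_gt0.
  set e := s / _ in e0.
  have es : e * (8 * (nsq (D y) + 1)) = s by rewrite /e divfK// gt_eqF.
  have [[N HN] [M HM]] := (Hg _ e0, archim _ e0).
  pose k := maxn N M.
  have [dk Fk] := Hxs k.
  have v1 := var _ _ _ dk dy Fk (e1 k).
  have v2 := HN k (leq_maxl _ _); have v3 := HM k (leq_maxr _ _).
  have v4 := CauchySchwarz (g - D (xs k)) (D y).
  have v5 := sqmodD_le (dot (g - D (xs k)) (D y)) (dot (D (xs k)) (D y) - phi y).
  move: v5; rewrite dotBl addrA subrK -/s -dotBl => v5.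
  rewrite nsqBC in v4.
  have v6 : nsq (D (xs k) - g) * nsq (D y) <= e * nsq (D y) by rewrite ler_wpM2r// ltW.
  have v7 : q k * nsq (D y) <= e * nsq (D y) by rewrite ler_wpM2r// ltW.
  nra.
exists g; split => //.
rewrite leNgt; apply/negP => cg.
have e0 : 0 < nsq g - c by lra.
have [x dx] := clos _ e0.
rewrite nsqB gphi// => h; have := phi_amgm dx; lra.
Qed.

End Riesz.

(** * Bounded operators *)

Section BoundedOperators.
Context {R : realType}.

Definition hlin {I J} (T : l2vec R I -> l2vec R J) :=
  forall a x y, T (a *: x + y) = a *: T x + T y.

(** The bound is on squared norms, so [M] is the square of an operator norm bound. *)
Definition opb {I J} (M : R) (T : l2vec R I -> l2vec R J) := forall x, nsq (T x) <= M * nsq x.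

Definition blin {I J} (T : l2vec R I -> l2vec R J) := hlin T /\ exists M : R, opb M T.

Section Linear.
Context {I J : choiceType} (T : l2vec R I -> l2vec R J) (Tl : hlin T).

Lemma hlin0 : T 0 = 0.
Proof.
have := Tl 1 0 0; rewrite !scale1r addr0 => h.
by apply: (addrI (T 0)); rewrite -h addr0.
Qed.

Lemma hlinZ a x : T (a *: x) = a *: T x.
Proof. by rewrite -[a *: x]addr0 Tl hlin0 addr0. Qed.

Lemma hlinD x y : T (x + y) = T x + T y.
Proof. by rewrite -[x in LHS]scale1r Tl scale1r. Qed.

Lemma hlinN x : T (- x) = - T x.
Proof. by rewrite -scaleN1r hlinZ scaleN1r. Qed.

Lemma hlinB x y : T (x - y) = T x - T y.
Proof. by rewrite hlinD hlinN. Qed.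

Lemma hlin_sum (K : Type) (s : seq K) (f : K -> l2vec R I) :
  T (\sum_(k <- s) f k) = \sum_(k <- s) T (f k).
Proof.
elim: s => [|k s IH]; first by rewrite !big_nil hlin0.
by rewrite !big_cons hlinD IH.
Qed.

End Linear.

Lemma opb_nneg {I J} (T : l2vec R I -> l2vec R J) M : opb M T -> opb `|M| T.
Proof.
move=> h x; apply: le_trans (h x) _; apply: ler_wpM2r; first exact: nsq_ge0.
exact: ler_norm.
Qed.

Lemma blin_id {I} : blin (@id (l2vec R I)).
Proof. by split; [move=> a x y | exists 1 => x; rewrite mul1r]. Qed.

Lemma blin_comp {I J K} (S : l2vec R J -> l2vec R K) (T : l2vec R I -> l2vec R J) :
  blin S -> blin T -> blin (S \o T).
Proof.
move=> [Sl [M /opb_nneg SM]] [Tl [N TN]]; split; first by move=> a x y /=; rewrite Tl Sl.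
exists (`|M| * N) => x /=; apply: le_trans (SM _) _; rewrite -mulrA.
exact: ler_wpM2l.
Qed.

Lemma blinD {I J} (S T : l2vec R I -> l2vec R J) : blin S -> blin T -> blin (fun x => S x + T x).
Proof.
move=> [Sl [M SM]] [Tl [N TN]]; split.
  by move=> a x y; rewrite Sl Tl scalerDr addrACA.
exists (2 * (M + N)) => x; apply: le_trans (nsqD_le _ _) _.
have := SM x; have := TN x; lra.
Qed.

Lemma blinZ {I J} a (S : l2vec R I -> l2vec R J) : blin S -> blin (fun x => a *: S x).
Proof.
move=> [Sl [M SM]]; split.
  by move=> b x y; rewrite Sl scalerDr !scalerA mulrC.
exists (sqmod a * M) => x; rewrite nsqZ -mulrA; apply: ler_wpM2l => //.
exact: sqmod_ge0.
Qed.

Lemma blinN {I J} (S : l2vec R I -> l2vec R J) : blin S -> blin (fun x => - S x).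
Proof.
move=> /(blinZ (-1)); congr blin; apply/funext => x; exact: scaleN1r.
Qed.

Lemma blinB {I J} (S T : l2vec R I -> l2vec R J) : blin S -> blin T -> blin (fun x => S x - T x).
Proof. by move=> Sb Tb; apply: blinD => //; exact: blinN. Qed.

(** ** Adjoints *)

Definition adjoint {I J} (T : l2vec R I -> l2vec R J) (S : l2vec R J -> l2vec R I) :=
  forall x y, dot y (T x) = dot (S y) x.

Definition hadj {I J} (T : l2vec R I -> l2vec R J) : l2vec R J -> l2vec R I :=
  xget (fun=> 0) [set S | adjoint T S].

Lemma adjoint_sym {I J} (T : l2vec R I -> l2vec R J) S : adjoint T S -> adjoint S T.
Proof. by move=> h x y; rewrite -dotJ -h dotJ. Qed.

Lemma adjoint_lin {I J} (T : l2vec R I -> l2vec R J) S : adjoint T S -> hlin T.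
Proof.
by move=> h a x y; apply: dot_ext => z; rewrite h !dotDr !dotZr !h.
Qed.

Lemma adjoint_unique {I J} (T : l2vec R I -> l2vec R J) S S' :
  adjoint T S -> adjoint T S' -> S = S'.
Proof. by move=> h h'; apply/funext => y; apply: dot_extl => z; rewrite -h h'. Qed.

(** From [|S y|^2 = <y, T (S y)>] and the Cauchy-Schwarz inequality. *)
Lemma adjoint_opb {I J} (T : l2vec R I -> l2vec R J) S M :
  adjoint T S -> 0 <= M -> opb M T -> opb M S.
Proof.
move=> h M0 TM y.
have e : dot y (T (S y)) = (nsq (S y))%:C by rewrite h dotxx.
have := CauchySchwarz y (T (S y)); rewrite e sqmodC => h1.
have h2 := TM (S y); have n1 := nsq_ge0 y; have n2 := nsq_ge0 (S y).
have h3 : nsq (S y) ^+ 2 <= nsq y * (M * nsq (S y)).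
  by apply: le_trans h1 _; exact: ler_wpM2l.
have [->|z] := eqVneq (nsq (S y)) 0; first by rewrite mulr_ge0.
have zp : 0 < nsq (S y) by rewrite lt_neqAle eq_sym z.
by rewrite -(ler_pM2r zp) -expr2 mulrAC mulrC.
Qed.

Lemma adjoint_exists {I J} (T : l2vec R I -> l2vec R J) : blin T -> exists S, adjoint T S.
Proof.
move=> [Tl [M /opb_nneg TM]].
have rep y : exists g, forall x, dot y (T x) = dot g x.
  have [||||||g [Hg _ _]] := @riesz_minimum R I I (fun=> True) id (fun x => dot y (T x))
    (`|M| * nsq y) => //.
  - by move=> a x x'; rewrite Tl dotDr dotZr.
  - by rewrite mulr_ge0 ?normr_ge0 ?nsq_ge0.
  - move=> x _; apply: le_trans (CauchySchwarz _ _) _.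
    rewrite [leRHS](_ : _ = nsq y * (`|M| * nsq x)); last by ring.
    by apply: ler_wpM2l; [exact: nsq_ge0|exact: TM].
  by exists g => x; rewrite Hg.
have [S HS] := choice rep.
by exists S => x y; rewrite HS.
Qed.

Lemma hadjP {I J} (T : l2vec R I -> l2vec R J) : blin T -> adjoint T (hadj T).
Proof. by move=> /adjoint_exists [S HS]; rewrite /hadj; case: xgetP => // /(_ S). Qed.

Lemma hadj_eq {I J} (T : l2vec R I -> l2vec R J) S : adjoint T S -> hadj T = S.
Proof.
move=> h; apply: (adjoint_unique (T := T)) => //.
by rewrite /hadj; case: xgetP => // /(_ S).
Qed.

Lemma adjoint_blin {I J} (T : l2vec R I -> l2vec R J) S : adjoint T S -> blin T -> blin S.
Proof.
move=> h [_ [M /opb_nneg TM]]; split; first exact: adjoint_lin (adjoint_sym h).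
by exists `|M|; apply: adjoint_opb h (normr_ge0 _) TM.
Qed.

Lemma hadj_blin {I J} (T : l2vec R I -> l2vec R J) : blin T -> blin (hadj T).
Proof. by move=> Tb; exact: adjoint_blin (hadjP Tb) Tb. Qed.

Lemma hadj_opb {I J} (T : l2vec R I -> l2vec R J) M : blin T -> 0 <= M -> opb M T -> opb M (hadj T).
Proof. by move=> Tb; exact: adjoint_opb (hadjP Tb). Qed.

Lemma hadjK {I J} (T : l2vec R I -> l2vec R J) : blin T -> hadj (hadj T) = T.
Proof. by move=> Tb; apply: hadj_eq; apply: adjoint_sym; exact: hadjP. Qed.

Lemma dot_hadj {I J} (T : l2vec R I -> l2vec R J) x y : blin T -> dot y (T x) = dot (hadj T y) x.
Proof. by move=> /hadjP; exact. Qed.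

Lemma hadj_dot {I J} (T : l2vec R I -> l2vec R J) x y : blin T -> dot (T x) y = dot x (hadj T y).
Proof. by move=> Tb; rewrite -dotJ dot_hadj// dotJ. Qed.

Lemma hadj_comp {I J K} (S : l2vec R J -> l2vec R K) (T : l2vec R I -> l2vec R J) :
  blin S -> blin T -> hadj (S \o T) = hadj T \o hadj S.
Proof. by move=> Sb Tb; apply: hadj_eq => x y /=; rewrite !dot_hadj. Qed.

Lemma nsq_gram {I J} (T : l2vec R I -> l2vec R J) x : blin T ->
  dot x (hadj T (T x)) = (nsq (T x))%:C.
Proof. by move=> Tb; rewrite -hadj_dot// dotxx. Qed.

(** The adjoint is determined by the values on the basis, coordinate by coordinate. *)
Lemma blin_delta_ext {I J} (S T : l2vec R I -> l2vec R J) : blin S -> blin T ->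
  (forall i, S (basis_vec i) = T (basis_vec i)) -> S = T.
Proof.
move=> Sb Tb e; rewrite -(hadjK Sb) -(hadjK Tb); congr hadj.
apply/funext => y; apply: l2vec_ext => i.
by rewrite -!dot_delta -!hadj_dot// e.
Qed.

Lemma hlim_blin {I J} (T : l2vec R I -> l2vec R J) u x : blin T -> hlim u x -> hlim (T \o u) (T x).
Proof.
move=> [Tl [M /opb_nneg TM]] ux e e0.
have M0 := normr_ge0 M; have p : 0 < `|M| + 1 by lra.
have [N HN] := ux _ (divr_gt0 e0 p).
exists N => n /HN h; rewrite /= -hlinB//; apply: le_lt_trans (TM _) _.
have := nsq_ge0 (u n - x); move: h; rewrite ltr_pdivlMr//; nra.
Qed.

Lemma closure_range_orth {I J} (D : l2vec R I -> l2vec R J) (dom : l2vec R I -> Prop) k g :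
  blin D -> hadj D k = 0 ->
  (forall e, 0 < e -> exists2 x, dom x & nsq (g - D x) < e) -> dot k g = 0.
Proof.
move=> Db k0 clos; apply/sqmod_eq0/eqP; rewrite eq_le sqmod_ge0 andbT leNgt.
apply/negP => lt0; have nk := nsq_ge0 k.
have p : 0 < nsq k + 1 by lra.
have [x _ Hx] := clos _ (divr_gt0 lt0 p).
have := CauchySchwarz k (g - D x).
rewrite dotBr (dot_hadj _ _ Db) k0 dot0l subr0.
by move: Hx; rewrite ltr_pdivlMr//; have := nsq_ge0 (g - D x); nra.
Qed.

(** ** Douglas factorization *)

(** The factor is built through its adjoint, whose value at [y] represents the
    functional [D x |-> <y, S x>] in the closure of the range of [D]. The last
    clause says that the factor vanishes on the orthogonal complement of that range. *)
Lemma douglas {I J K} (D : l2vec R I -> l2vec R J) (S : l2vec R I -> l2vec R K) (M : R) :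
  blin D -> blin S -> 0 <= M -> (forall x, nsq (S x) <= M * nsq (D x)) ->
  exists V : l2vec R J -> l2vec R K,
    [/\ blin V, opb M V, forall x, V (D x) = S x &
        forall k y, hadj D k = 0 -> dot k (hadj V y) = 0].
Proof.
move=> Db Sb M0 le.
have [[Dl _] [Sl _]] := (Db, Sb).
have rep y : exists g, [/\ forall x, dot g (D x) = dot y (S x),
    forall k, hadj D k = 0 -> dot k g = 0 & nsq g <= M * nsq y].
  have [||||||g [Hg clos gM]] := @riesz_minimum R I J (fun=> True) D (fun x => dot y (S x))
    (M * nsq y) => //.
  - by move=> a x x'; rewrite Sl dotDr dotZr.
  - by rewrite mulr_ge0 ?nsq_ge0.
  - move=> x _; apply: le_trans (CauchySchwarz _ _) _.
    rewrite [leRHS](_ : _ = nsq y * (M * nsq (D x))); last by ring.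
    by apply: ler_wpM2l; [exact: nsq_ge0|exact: le].
  exists g; split=> [x|k k0|//]; first by rewrite Hg.
  exact: closure_range_orth Db k0 clos.
have [W HW] := choice rep.
have Wuniq y g : (forall x, dot g (D x) = dot y (S x)) ->
    (forall k, hadj D k = 0 -> dot k g = 0) -> W y = g.
  move=> h1 h2; apply/eqP; rewrite -subr_eq0; apply/eqP.
  have d0 : hadj D (W y - g) = 0.
    apply: dot_extl => x; rewrite -dot_hadj// dotBl h1 dot0l.
    by case: (HW y) => -> _ _; rewrite subrr.
  apply: nsq_eq0; rewrite nsqE dotBr h2//; case: (HW y) => _ -> // _.
  by rewrite subrr.
have Wl : hlin W.
  move=> a y y'; have [h1 h2 _] := HW y; have [h1' h2' _] := HW y'.
  apply: Wuniq => [x|k k0].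
    by rewrite dotDl dotZl h1 h1' dotDl dotZl.
  by rewrite dotDr dotZr h2// h2'// mulr0 addr0.
have WM : opb M W by move=> y; case: (HW y).
have Wb : blin W by split=> //; exists M.
exists (hadj W); split.
- exact: hadj_blin.
- exact: hadj_opb.
- move=> x; apply: dot_ext => y; rewrite -hadj_dot//.
  by case: (HW y).
- by move=> k y k0; rewrite hadjK//; case: (HW y) => _ + _; exact.
Qed.

End BoundedOperators.
Global Opaque hadj.

(** * Positive square roots *)

Section SquareRoot.
Context {R : realType}.

Lemma hlim_dot_eq {I J} (u : nat -> l2vec R I) (v : nat -> l2vec R J) x y a b :
  hlim u x -> hlim v y -> (forall n, dot a (u n) = dot (v n) b) -> dot a x = dot y b.
Proof.
move=> ux vy e; apply/eqP; rewrite -subr_eq0; apply/eqP/sqmod_eq0/eqP.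
rewrite eq_le sqmod_ge0 andbT leNgt; apply/negP => lt0.
have e0 : 0 < sqmod (dot a x - dot y b) / 4 by rewrite divr_gt0.
have [[N HN] [M HM]] := (hlim_dot_small a ux e0, hlim_dot_small b vy e0).
have := HN (maxn N M) (leq_maxl _ _); have := HM (maxn N M) (leq_maxr _ _).
have := sqmodD_le (dot a x - dot a (u (maxn N M))) (dot a (u (maxn N M)) - dot y b).
rewrite addrA subrK -(sqmodN (dot a x - dot a (u _))) opprB {2}e.
rewrite -(sqmodJ (dot b _ - _)) -dotBr dotJ dotBl; lra.
Qed.

Lemma nsqD_bound {I} (x y : l2vec R I) (a b n : R) : 0 <= a -> 0 <= b -> 0 <= n ->
  nsq x <= a ^+ 2 * n -> nsq y <= b ^+ 2 * n -> nsq (x + y) <= (a + b) ^+ 2 * n.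
Proof.
move=> a0 b0 n0 hx hy; rewrite nsqD; set r := complex.Re _.
have r2 : r ^+ 2 <= (a * b * n) ^+ 2.
  apply: le_trans (Re_sq_le _) _; apply: le_trans (CauchySchwarz _ _) _.
  rewrite (_ : (a * b * n) ^+ 2 = (a ^+ 2 * n) * (b ^+ 2 * n)); last by ring.
  by apply: ler_pM => //; exact: nsq_ge0.
have abn : 0 <= a * b * n by rewrite !mulr_ge0.
have rle : r <= a * b * n.
  by rewrite leNgt; apply/negP => lt; nra.
rewrite (_ : _ * n = a ^+ 2 * n + b ^+ 2 * n + 2 * (a * b * n)); last by ring.
lra.
Qed.

Variables (I : choiceType) (A : l2vec R I -> l2vec R I).

(** The iteration [Y |-> (A + Y^2) / 2] converges to [1 - sqrt (1 - A)] for every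
    self-adjoint contraction [A]. *)
Fixpoint rootseq n (x : l2vec R I) : l2vec R I :=
  if n is m.+1 then (2^-1)%:C *: (A x + rootseq m (rootseq m x)) else 0.

Definition rootlim x : l2vec R I := xget 0 [set y | hlim (rootseq^~ x) y].

Definition oproot x : l2vec R I := x - rootlim x.

(** The same iteration at the number 1, which dominates the operator one. *)
Fixpoint rootbound n : R := if n is m.+1 then (1 + rootbound m ^+ 2) / 2 else 0.

Lemma rootbound_itv n : 0 <= rootbound n /\ rootbound n <= 1.
Proof. by elim: n => [|n [h0 h1]] /=; [rewrite lexx ler01 | split; nra]. Qed.

Lemma rootbound_step n : rootbound n <= rootbound n.+1.
Proof. by have [h0 h1] := rootbound_itv n; rewrite /=; nra. Qed.

Lemma rootbound_cauchy e : 0 < e ->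
  exists N, forall m n, (N <= m)%N -> (m <= n)%N -> (rootbound n - rootbound m) ^+ 2 < e.
Proof.
move=> e0.
have mono m n : (m <= n)%N -> rootbound m <= rootbound n.
  move=> mn; rewrite -(subnK mn); elim: (n - m)%N => [//|k IH].
  by rewrite addSn; apply: le_trans IH (rootbound_step _).
pose E := [set rootbound n | n in [set: nat]].
have sE : has_sup E.
  split; first by exists (rootbound 0), 0%N.
  by exists 1 => _ [n _ <-]; case: (rootbound_itv n).
have d0 : 0 < Num.min 1 e by rewrite lt_min ltr01.
have [_ [N _ <-] HN] := sup_adherent d0 sE.
have ub n : rootbound n <= sup E by apply: ub_le_sup; [exact: sE.2|exists n].
exists N => m n Nm mn.
have [l1 l2] : Num.min 1 e <= 1 /\ Num.min 1 e <= e by rewrite !ge_min !lexx orbT.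
set d := Num.min 1 e in d0 HN l1 l2.
have := mono _ _ Nm; have := mono _ _ mn; have := ub n.
set s := sup E in HN *; nra.
Qed.

Hypothesis Asa : adjoint A A.
Hypothesis A1 : opb 1 A.

Let Al : hlin A. Proof. exact: adjoint_lin Asa. Qed.

Lemma rootseq_lin n : hlin (rootseq n).
Proof.
elim: n => [|n IH] a x y /=; first by rewrite scaler0 addr0.
rewrite Al !IH [a *: (_ *: _)]scalerA [a * _]mulrC -[(_ * a) *: _]scalerA -scalerDr.
by congr (_ *: _); rewrite scalerDr addrACA.
Qed.

Lemma rootseq_adjoint n : adjoint (rootseq n) (rootseq n).
Proof.
elim: n => [|n IH] x y /=; first by rewrite dot0r dot0l.
by rewrite dotZr dotZl conjc_real dotDr dotDl !IH Asa.
Qed.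

Lemma rootseq_bound n x : nsq (rootseq n x) <= rootbound n ^+ 2 * nsq x.
Proof.
elim: n x => [|n IH] x /=; first by rewrite nsq0 expr0n mul0r.
have [h0 h1] := rootbound_itv n.
have b : nsq (A x + rootseq n (rootseq n x)) <= (1 + rootbound n ^+ 2) ^+ 2 * nsq x.
  apply: nsqD_bound; rewrite ?ler01 ?sqr_ge0 ?nsq_ge0//.
    by rewrite expr1n; exact: A1.
  apply: le_trans (IH _) _; rewrite [(_ ^+ 2) ^+ 2]expr2 -mulrA.
  by apply: ler_wpM2l; rewrite ?sqr_ge0.
rewrite nsqZ sqmodC (_ : _ * nsq x = 2^-1 ^+ 2 * ((1 + rootbound n ^+ 2) ^+ 2 * nsq x)); last by ring.
by apply: ler_wpM2l; rewrite ?sqr_ge0.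
Qed.

(** Induction on [Y_(n+2) - Y_(n+1) = (Y_(n+1) (Y_(n+1) - Y_n) + (Y_(n+1) - Y_n) Y_n) / 2]. *)
Lemma rootseq_step n x :
  nsq (rootseq n.+1 x - rootseq n x) <= (rootbound n.+1 - rootbound n) ^+ 2 * nsq x.
Proof.
elim: n x => [|n IH] x.
  rewrite [rootseq 0 x]/= !subr0; exact: (rootseq_bound 1).
have [h0 h1] := rootbound_itv n; have [k0 k1] := rootbound_itv n.+1.
have st := rootbound_step n.
set r := rootbound n in h0 h1 st IH *; set s := rootbound n.+1 in k0 k1 st IH *.
rewrite (_ : rootbound n.+2 - s = 2^-1 * (s * (s - r) + (s - r) * r)); last first.
  rewrite (_ : rootbound n.+2 = (1 + s ^+ 2) / 2)// [X in _ - X](_ : s = (1 + r ^+ 2) / 2)//.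
  by field.
have e : rootseq n.+2 x - rootseq n.+1 x =
    (2^-1)%:C *: (rootseq n.+1 (rootseq n.+1 x - rootseq n x) +
      (rootseq n.+1 (rootseq n x) - rootseq n (rootseq n x))).
  rewrite (hlinB (rootseq_lin n.+1)) addrA subrK.
  rewrite [rootseq n.+2 x]/= [X in _ - X]/= -scalerBr; congr (_ *: _).
  by rewrite opprD addrACA subrr add0r.
rewrite e nsqZ sqmodC [leRHS](_ : _ = 2^-1 ^+ 2 * ((s * (s - r) + (s - r) * r) ^+ 2 * nsq x));
  last by ring.
apply: ler_wpM2l; rewrite ?sqr_ge0//.
have sr : 0 <= s - r by lra.
have a1 : 0 <= s * (s - r) by exact: mulr_ge0.
have a2 : 0 <= (s - r) * r by exact: mulr_ge0.
apply: (nsqD_bound a1 a2 (nsq_ge0 x)).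
  apply: le_trans (rootseq_bound _ _) _; rewrite -/s [leRHS](_ : _ = s ^+ 2 * ((s - r) ^+ 2 * nsq x)); last by ring.
  by apply: ler_wpM2l; rewrite ?sqr_ge0.
apply: le_trans (IH _) _.
rewrite [leRHS](_ : _ = (s - r) ^+ 2 * (r ^+ 2 * nsq x)); last by ring.
by apply: ler_wpM2l; rewrite ?sqr_ge0//; exact: rootseq_bound.
Qed.

Lemma rootseq_dist m k x :
  nsq (rootseq (k + m) x - rootseq m x) <= (rootbound (k + m) - rootbound m) ^+ 2 * nsq x.
Proof.
have mono : rootbound m <= rootbound (k + m).
  by elim: k => [//|k IH]; apply: le_trans IH (rootbound_step _).
elim: k mono => [|k IH] _; first by rewrite !add0n !subrr nsq0 expr0n mul0r.
have mono : rootbound m <= rootbound (k + m).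
  by elim: k {IH} => [//|k IH]; apply: le_trans IH (rootbound_step _).
have st := rootbound_step (k + m).
rewrite addSn (_ : _ - _ = (rootseq (k + m).+1 x - rootseq (k + m) x) +
  (rootseq (k + m) x - rootseq m x)); last by rewrite addrA subrK.
rewrite (_ : rootbound (k + m).+1 - _ = (rootbound (k + m).+1 - rootbound (k + m)) +
  (rootbound (k + m) - rootbound m)); last by rewrite addrA subrK.
apply: nsqD_bound; rewrite ?subr_ge0 ?nsq_ge0//; [exact: rootseq_step|exact: IH].
Qed.

Lemma rootlimP x : hlim (rootseq^~ x) (rootlim x).
Proof.
suff [y Hy] : exists y, hlim (rootseq^~ x) y by exact: (xgetPex 0 (ex_intro _ y Hy)).
apply: l2vec_complete => e e0; have x0 := nsq_ge0 x.
have p : 0 < nsq x + 1 by lra.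
have [N HN] := rootbound_cauchy (divr_gt0 e0 p).
have half m n : (N <= m)%N -> (m <= n)%N -> nsq (rootseq n x - rootseq m x) < e.
  move=> Nm mn; have := HN _ _ Nm mn; have := rootseq_dist m (n - m) x.
  by rewrite subnK// => h1; rewrite ltr_pdivlMr//; have := sqr_ge0 (rootbound n - rootbound m); nra.
exists N => m n Nm Nn; have [mn|nm] := leqP m n.
  by rewrite nsqBC; exact: half.
by apply: half => //; exact: ltnW.
Qed.

Lemma rootlim_adjoint : adjoint rootlim rootlim.
Proof.
move=> x y; apply: hlim_dot_eq (rootlimP x) (rootlimP y) _ => n.
exact: rootseq_adjoint.
Qed.

Lemma rootlim_opb : opb 1 rootlim.
Proof.
move=> x; rewrite mul1r; apply: hlim_nsq_le (rootlimP x) _ => n.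
apply: le_trans (rootseq_bound n x) _; have [h0 h1] := rootbound_itv n.
by rewrite -[leRHS]mul1r; apply: ler_wpM2r; rewrite ?nsq_ge0 ?expr_le1.
Qed.

Let quarter_sum (a b c e : R) : a <= 2 * (b + c) -> b < e / 4 -> c < e / 4 -> a < e.
Proof. lra. Qed.

(** Both sides of the recursion converge. *)
Lemma rootlim_eq x : rootlim x + rootlim x = A x + rootlim (rootlim x).
Proof.
have rl := adjoint_lin rootlim_adjoint.
have h1 : hlim (fun n => rootseq n (rootseq n x)) (rootlim (rootlim x)).
  move=> e e0; have e4 : 0 < e / 4 by rewrite divr_gt0.
  have [[N HN] [M HM]] := (rootlimP x e4, rootlimP (rootlim x) e4).
  exists (maxn N M) => n; rewrite geq_max => /andP [/HN k1 /HM k2].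
  have := nsqD_le (rootseq n (rootseq n x - rootlim x))
    (rootseq n (rootlim x) - rootlim (rootlim x)).
  rewrite (hlinB (rootseq_lin n)) addrA subrK => k3.
  have [b0 b1] := rootbound_itv n.
  have k4 : nsq (rootseq n (rootseq n x) - rootseq n (rootlim x)) <= nsq (rootseq n x - rootlim x).
    rewrite -(hlinB (rootseq_lin n)); apply: le_trans (rootseq_bound n _) _.
    by rewrite ler_piMl ?nsq_ge0// expr_le1.
  exact: quarter_sum k3 (le_lt_trans k4 k1) k2.
have h2 : hlim (fun n => rootseq n.+1 x) (rootlim x).
  by move=> e /(rootlimP x) [N HN]; exists N => n Nn; apply: HN; exact: leqW.
have h3 : hlim (fun n => rootseq n.+1 x) ((2^-1)%:C *: (A x + rootlim (rootlim x))).
  exact: hlimZ (hlimD (hlim_cst (A x)) h1).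
rewrite (hlim_unique h2 h3) -scalerDl.
rewrite -rmorphD /= (_ : 2^-1 + 2^-1 = 1 :> R) ?scale1r -?(hlim_unique h2 h3)//.
by field.
Qed.

Lemma oproot_adjoint : adjoint oproot oproot.
Proof. by move=> x y; rewrite /oproot dotBr dotBl rootlim_adjoint. Qed.

Lemma oproot_blin : blin oproot.
Proof.
apply: blinB; first exact: blin_id.
by split; [exact: adjoint_lin rootlim_adjoint | exists 1; exact: rootlim_opb].
Qed.

Lemma oproot_ge0 x : 0 <= dot x (oproot x).
Proof.
have im0 (z : R[i]) : conjc z = z -> 0 <= complex.Re z -> 0 <= z.
  case: z => a b [] /= h a0; rewrite lecE /= a0 andbT; apply/eqP; lra.
apply: im0; first by rewrite dotJ -oproot_adjoint.
rewrite /oproot dotBr dotxx ReD ReN /= subr_ge0.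
have x0 := nsq_ge0 x; set r := complex.Re _.
have : r ^+ 2 <= nsq x ^+ 2.
  apply: le_trans (Re_sq_le _) _; apply: le_trans (CauchySchwarz _ _) _.
  by rewrite expr2; apply: ler_wpM2l => //; have := rootlim_opb x; rewrite mul1r.
by move=> h; rewrite leNgt; apply/negP => lt; nra.
Qed.

Lemma oprootK x : oproot (oproot x) = x - A x.
Proof.
have rl := adjoint_lin rootlim_adjoint.
rewrite /oproot (hlinB rl).
have -> : A x = rootlim x + rootlim x - rootlim (rootlim x).
  by rewrite rootlim_eq addrK.
by rewrite -[LHS]addrA -opprD addrA.
Qed.

End SquareRoot.

Section SquareRootTheory.
Context {R : realType}.

(** Everything that intertwines two operators intertwines the iterations, hence the roots. *)
Lemma oproot_intertwine {I J} (A : l2vec R I -> l2vec R I) (B : l2vec R J -> l2vec R J)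
    (Z : l2vec R I -> l2vec R J) :
  adjoint A A -> opb 1 A -> adjoint B B -> opb 1 B -> blin Z ->
  (forall x, Z (A x) = B (Z x)) -> forall x, Z (oproot A x) = oproot B (Z x).
Proof.
move=> Asa A1 Bsa B1 Zb ZA x; have [Zl _] := Zb.
have seq n y : Z (rootseq A n y) = rootseq B n (Z y).
  elim: n y => [|n IH] y /=; first exact: hlin0.
  by rewrite (hlinZ Zl) (hlinD Zl) ZA !IH.
rewrite /oproot (hlinB Zl); congr (_ - _).
have h1 := hlim_blin Zb (rootlimP Asa A1 x).
apply: hlim_unique h1 _ => e /(rootlimP Bsa B1 (Z x)) [N HN].
by exists N => n /HN; rewrite /= seq.
Qed.

(** Over the complex numbers a positive form is Hermitian, by polarization with 1 and i. *)
Lemma positive_adjoint {I} (S : l2vec R I -> l2vec R I) :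
  hlin S -> (forall x, 0 <= dot x (S x)) -> adjoint S S.
Proof.
move=> Sl pos.
pose f x y := dot x (S y) - dot (S x) y.
have f0 x : f x x = 0.
  rewrite /f -(dotJ x (S x)); have := pos x.
  case: (dot _ _) => a b; rewrite lecE /= => /andP [/eqP b0 _].
  by rewrite b0 oppr0 subrr.
have fDl x y z : f (x + y) z = f x z + f y z.
  by rewrite /f (hlinD Sl) !dotDl; ring.
have fDr x y z : f x (y + z) = f x y + f x z.
  by rewrite /f (hlinD Sl) !dotDr; ring.
have fZl a x z : f (a *: x) z = conjc a * f x z.
  by rewrite /f (hlinZ Sl) !dotZl; ring.
have fZr a x z : f x (a *: z) = a * f x z.
  by rewrite /f (hlinZ Sl) !dotZr; ring.
have anti x y : f x y + f y x = 0.
  by have := f0 (x + y); rewrite fDl !fDr !f0; rewrite add0r addr0.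
move=> x y; apply/eqP; rewrite -subr_eq0; apply/eqP; rewrite -/(f y x).
pose im : R[i] := Complex 0 1.
have h1 := anti x y; have := anti x (im *: y); rewrite fZl fZr.
have -> : conjc im = - im by apply: complex_ext; rewrite /im /= ?oppr0.
have i0 : im != 0 by rewrite eq_complex /= oner_eq0 andbF.
rewrite mulNr -mulrBr => /eqP; rewrite mulf_eq0 (negbTE i0) /= subr_eq0 => /eqP h2.
move: h1; rewrite h2 -mulr2n => /eqP; rewrite -mulr_natl mulf_eq0 pnatr_eq0 /=.
by move/eqP.
Qed.

(** The form at [y - t P y] is nonnegative for every real [t], and its linear term
    in [t] is [-2 |P y|^2]. *)
Lemma positive_ker {I} (P : l2vec R I -> l2vec R I) y : blin P ->
  (forall x, 0 <= dot x (P x)) -> dot y (P y) = 0 -> P y = 0.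
Proof.
move=> [Pl [M /opb_nneg PM]] pos y0; have Psa := positive_adjoint Pl pos.
have tvar (t : R) : 0 <= t ^+ 2 * complex.Re (dot (P y) (P (P y))) - 2 * t * nsq (P y).
  have := pos (y - t%:C *: P y).
  rewrite (hlinB Pl) (hlinZ Pl) !dotBl !dotBr !dotZl !dotZr conjc_real y0 (Psa (P y) y) dotxx.
  rewrite lecE => /andP [_]; rewrite !(ReD, ReN, ReM) /=; lra.
apply: nsq_eq0; set n := nsq (P y) in tvar *; have n0 : 0 <= n by exact: nsq_ge0.
set q := complex.Re _ in tvar.
have : q ^+ 2 <= `|M| * n ^+ 2.
  apply: le_trans (Re_sq_le _) _; apply: le_trans (CauchySchwarz _ _) _.
  rewrite -/n [leRHS](_ : _ = n * (`|M| * n)); last by ring.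
  by apply: ler_wpM2l => //; exact: PM.
have [->//|nn] := eqVneq n 0.
have np : 0 < n by rewrite lt_neqAle eq_sym nn.
have q1 := ler_norm q; have q2 := normr_ge0 q.
have [k kE kp] : exists2 k, k = `|q| + 1 & 0 < k by exists (`|q| + 1) => //; lra.
have := tvar (n / k).
rewrite (_ : _ - _ = n ^+ 2 * (q - 2 * k) / k ^+ 2); last by field; rewrite gt_eqF.
rewrite pmulr_lge0 ?invr_gt0 ?exprn_gt0// pmulr_rge0 ?exprn_gt0//; lra.
Qed.

(** A positive root [S] commutes with [A = 1 - S^2], hence with [T = oproot A].
    Then [y = S x - T x] satisfies [(S + T) y = 0], so both positive forms vanish at
    [y], and [S y = T y = 0] forces [y = 0]. *)
Lemma positive_root_unique {I} (A S : l2vec R I -> l2vec R I) :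
  adjoint A A -> opb 1 A -> blin S -> (forall x, 0 <= dot x (S x)) ->
  (forall x, S (S x) = x - A x) -> S = oproot A.
Proof.
move=> Asa A1 Sb pos SS; have [Sl _] := Sb.
have Tb := oproot_blin Asa A1; have [Tl _] := Tb.
set T := oproot A in Tb Tl *.
have TT x : T (T x) = x - A x by exact: oprootK.
have comm x : S (T x) = T (S x).
  apply: oproot_intertwine => // y.
  have -> : A y = y - S (S y) by rewrite SS opprB addrC subrK.
  by rewrite (hlinB Sl) [S (S (S y))]SS opprB addrC subrK.
apply/funext => x; pose y := S x - T x.
have sum0 : S y + T y = 0.
  rewrite /y (hlinB Sl) (hlinB Tl) SS TT comm addrA subrK.
  by rewrite subrr.
have Tpos := oproot_ge0 Asa A1.
have yy : dot y (S y) = 0 /\ dot y (T y) = 0.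
  have : dot y (S y) + dot y (T y) = 0 by rewrite -dotDr sum0 dot0r.
  by move=> /eqP; rewrite paddr_eq0// => /andP [/eqP ? /eqP ?].
have Sy : S y = 0 by apply: positive_ker => //; case: yy.
have Ty : T y = 0 by apply: positive_ker => //; case: yy.
apply/eqP; rewrite -subr_eq0 -/y; apply/eqP/nsq_eq0.
rewrite nsqE {2}/y dotBr (positive_adjoint Sl pos) (oproot_adjoint Asa A1) -/T.
by rewrite Sy Ty subrr.
Qed.

End SquareRootTheory.
Global Opaque oproot.

(** ** Operators on all functions and operators on square-summable families *)

Section Packing.
Context {R : realType}.

Definition to_l2vec {I} (f : vec R I) : l2vec R I :=
  if pselect (l2 f) is left lf then L2Vec lf else 0.

Lemma to_l2vecK {I} (f : vec R I) : l2 f -> l2val (to_l2vec f) = f.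
Proof. by move=> lf; rewrite /to_l2vec; case: pselect. Qed.

Lemma l2valK {I} (x : l2vec R I) : to_l2vec x = x.
Proof. by apply: l2vec_ext => i; rewrite to_l2vecK//; exact: l2valP. Qed.

Definition pack {I J} (T : op R I J) : l2vec R I -> l2vec R J := fun x => to_l2vec (T x).

Definition unpack {I J} (T : l2vec R I -> l2vec R J) : op R I J := fun f => T (to_l2vec f).

Lemma inner_dot {I} (x y : l2vec R I) : inner x y = dot x y.
Proof. by rewrite dotE. Qed.

Lemma bounded_l2 {I J} (T : op R I J) (f : vec R I) : bounded T -> l2 f -> l2 (T f).
Proof.
move=> [M TM] lf; apply: le_lt_trans (TM _ lf) _.
by rewrite (norm2_nsq (L2Vec lf)) -EFinM ltry.
Qed.

Section OfOp.
Context {I J : choiceType} (T : op R I J) (Tb : bounded_linear T).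

Lemma packE (x : l2vec R I) : l2val (pack T x) = T x.
Proof. by rewrite to_l2vecK//; apply: bounded_l2 (l2valP x); case: Tb. Qed.

Lemma pack_blin : blin (pack T).
Proof.
have [[M TM] Tl] := Tb; split.
  move=> a x y; apply: l2vec_ext => j; rewrite packE l2valD l2valZ !packE.
  by rewrite -[RHS]/((fun j => a * T x j + T y j) j) -Tl//; exact: l2valP.
exists (M ^+ 2) => x; rewrite -lee_fin EFinM -!norm2_nsq packE.
by apply: TM; exact: l2valP.
Qed.

Lemma pack_opb (c : R) : (forall f, l2 f -> (norm2 (T f) <= c%:E * norm2 f)%E) -> opb c (pack T).
Proof.
by move=> h x; rewrite -lee_fin EFinM -!norm2_nsq packE; apply: h; exact: l2valP.
Qed.

Lemma unpack_adjoint S : adjoint (pack T) S -> is_adjoint T (unpack S).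
Proof.
move=> h; split=> [y ly|x y lx ly]; first exact: l2valP.
rewrite -[y in LHS](to_l2vecK ly) -[x](to_l2vecK lx) -packE !inner_dot h.
by rewrite /unpack.
Qed.

Lemma adj_pack (y : l2vec R J) : adj T y = hadj (pack T) y.
Proof.
have [l2S adjS] := xgetPex (fun=> fun=> 0)
  (ex_intro [set S | is_adjoint T S] _ (unpack_adjoint (hadjP pack_blin))).
have ly := l2S _ (l2valP y).
have <- : L2Vec ly = hadj (pack T) y; last by [].
apply: dot_extl => x; rewrite -dot_hadj//; last exact: pack_blin.
rewrite -!inner_dot packE -[RHS]/(inner y (T x)) adjS//; exact: l2valP.
Qed.

End OfOp.

Lemma unpack_bounded_linear {I J} (T : l2vec R I -> l2vec R J) : blin T -> bounded_linear (unpack T).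
Proof.
move=> [Tl [M /opb_nneg TM]]; split.
  exists (Num.sqrt `|M|) => f lf; rewrite sqr_sqrtr ?normr_ge0//.
  by rewrite -[f in leRHS](to_l2vecK lf) !norm2_nsq -EFinM lee_fin; exact: TM.
move=> z f g lf lg; apply/funext => j; rewrite /unpack -[RHS]/((z *: T (to_l2vec f) + T (to_l2vec g)) j).
rewrite -Tl; congr (l2val (T _) j); apply: l2vec_ext => i.
by rewrite to_l2vecK ?l2valD ?l2valZ ?to_l2vecK//; apply: l2D => //; exact: l2Z.
Qed.

(** [psqrt] chooses some positive root; uniqueness identifies it with the limit of the
    iteration. *)
Lemma psqrt_oproot {I} (A : op R I I) (B : l2vec R I -> l2vec R I) :
  adjoint B B -> opb 1 B -> (forall x : l2vec R I, A x = l2val (x - B x)) ->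
  pack (psqrt A) = oproot B /\ bounded_linear (psqrt A).
Proof.
move=> Bsa B1 AB.
have rb := oproot_blin Bsa B1.
have ex : is_psqrt A (unpack (oproot B)).
  split; first exact: unpack_bounded_linear.
    by move=> h lh; rewrite -[h in X in inner X](to_l2vecK lh) inner_dot; exact: oproot_ge0.
  by move=> h lh; rewrite /unpack l2valK (oprootK Bsa B1) -AB to_l2vecK.
have [Sb Spos SS] : is_psqrt A (psqrt A) by apply: (xgetPex (fun=> fun=> 0)); exists (unpack (oproot B)).
split=> //; apply: positive_root_unique => //; first exact: pack_blin.
  by move=> x; rewrite -inner_dot packE//; apply: Spos; exact: l2valP.
move=> x; apply: l2vec_ext => i; rewrite packE// packE// SS ?AB//; exact: l2valP.
Qed.

End Packing.

(** * The range space of a defect operator *)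

Section Defect.
Context {R : realType} {I J : choiceType} (C : l2vec R I -> l2vec R J).

Definition defect : l2vec R I -> l2vec R I := oproot (fun x => hadj C (C x)).
Definition codefect : l2vec R J -> l2vec R J := oproot (fun y => C (hadj C y)).

Hypothesis Cb : blin C.
Hypothesis C1 : opb 1 C.

Let Cl : hlin C. Proof. by case: Cb. Qed.
Let C'b : blin (hadj C). Proof. exact: hadj_blin. Qed.
Let C'1 : opb 1 (hadj C). Proof. exact: hadj_opb. Qed.
Let C'l : hlin (hadj C). Proof. by case: C'b. Qed.

Let gram_sa : adjoint (fun x => hadj C (C x)) (fun x => hadj C (C x)).
Proof. by move=> x y; rewrite -hadj_dot// -dot_hadj. Qed.

Let gram_1 : opb 1 (fun x => hadj C (C x)).
Proof.
move=> x; apply: le_trans (C'1 _) _; rewrite !mul1r; apply: le_trans (C1 _) _.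
by rewrite mul1r.
Qed.

Let cogram_sa : adjoint (fun y => C (hadj C y)) (fun y => C (hadj C y)).
Proof. by move=> x y; rewrite (dot_hadj _ _ Cb) (hadj_dot _ _ Cb). Qed.

Let cogram_1 : opb 1 (fun y => C (hadj C y)).
Proof.
move=> x; apply: le_trans (C1 _) _; rewrite !mul1r; apply: le_trans (C'1 _) _.
by rewrite mul1r.
Qed.

Lemma defect_blin : blin defect. Proof. exact: oproot_blin. Qed.
Lemma defect_lin : hlin defect. Proof. by case: defect_blin. Qed.
Lemma defect_adjoint : adjoint defect defect. Proof. exact: oproot_adjoint. Qed.
Lemma defectK x : defect (defect x) = x - hadj C (C x). Proof. exact: oprootK. Qed.

Lemma hadj_defect : hadj defect = defect. Proof. exact: hadj_eq defect_adjoint. Qed.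

Lemma codefect_blin : blin codefect. Proof. exact: oproot_blin. Qed.
Lemma codefect_lin : hlin codefect. Proof. by case: codefect_blin. Qed.
Lemma codefect_adjoint : adjoint codefect codefect. Proof. exact: oproot_adjoint. Qed.
Lemma codefectK y : codefect (codefect y) = y - C (hadj C y). Proof. exact: oprootK. Qed.

Lemma dot_defect x y : dot (defect x) (defect y) = dot x y - dot (C x) (C y).
Proof. by rewrite -defect_adjoint defectK dotBr -(hadj_dot _ _ Cb). Qed.

Lemma nsq_defect x : nsq (defect x) = nsq x - nsq (C x).
Proof. by rewrite !nsqE dot_defect ReD ReN. Qed.

(** [C] intertwines its two Gram operators, hence their defect operators. *)
Lemma defect_intertwine x : C (defect x) = codefect (C x).
Proof. exact: oproot_intertwine. Qed.

Lemma hadj_defect_intertwine y : hadj C (codefect y) = defect (hadj C y).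
Proof. exact: oproot_intertwine. Qed.

(** Orthogonality to the kernel, i.e. membership in the closure of the range. *)
Definition defect_space (g : l2vec R I) := forall k, defect k = 0 -> dot k g = 0.

(** [model_pair f g] says that [(f, g)] is orthogonal to all [(C x, D x)], where [D]
    is the defect operator, and that [g] lies in the closed range of [D]. These
    pairs form the Sz.-Nagy--Foias model of the range space of [codefect]: [f]
    determines [g], and the norm of the space at [f] is that of [(f, g)]. *)
Definition model_pair (f : l2vec R J) (g : l2vec R I) :=
  hadj C f + defect g = 0 /\ defect_space g.

(** The preimage of [f] under [codefect] that is orthogonal to the kernel. *)
Definition model_lift f g := codefect f - C g.

Lemma model_liftP f g : model_pair f g ->
  codefect (model_lift f g) = f /\
  forall k, codefect k = 0 -> dot k (model_lift f g) = 0.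
Proof.
move=> [fg gK]; split.
  rewrite /model_lift (hlinB codefect_lin) codefectK -defect_intertwine.
  by rewrite -addrA -opprD -(hlinD Cl) fg (hlin0 Cl) subr0.
move=> k k0; rewrite /model_lift dotBr codefect_adjoint k0 dot0l sub0r.
rewrite (dot_hadj _ _ Cb) gK ?oppr0//.
by rewrite -hadj_defect_intertwine k0 (hlin0 C'l).
Qed.

Lemma model_lift_dot f g f' g' : model_pair f g -> model_pair f' g' ->
  dot (model_lift f g) (model_lift f' g') = dot f f' + dot g g'.
Proof.
move=> fg fg'; have [h1 _] := model_liftP fg.
have [e _] := fg; have [e' _] := fg'.
have dg' : defect g' = - hadj C f' by apply/eqP; rewrite -addr_eq0 addrC e'.
have dg : defect g = - hadj C f by apply/eqP; rewrite -addr_eq0 addrC e.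
rewrite {2}/model_lift dotBr codefect_adjoint h1; congr (_ + _).
rewrite (dot_hadj _ _ Cb) /model_lift (hlinB C'l) hadj_defect_intertwine dotBl.
have -> : dot (defect (hadj C f)) g' = - dot (hadj C f) (hadj C f').
  by rewrite -defect_adjoint dg' dotNr.
have -> : dot (hadj C (C g)) g' = dot g g' - dot (hadj C f) (hadj C f').
  have := dot_defect g g'; rewrite dg dg' dotNl dotNr opprK => ->.
  by rewrite opprB addrC subrK -(dot_hadj _ _ Cb).
by rewrite opprB opprK subrK.
Qed.

End Defect.

Section RangeSpace.
Context {R : realType} {I J : choiceType} (T : op R I J).
Hypothesis Tb : bounded_linear T.
Hypothesis T1 : contraction T.

Let Cb : blin (pack T). Proof. exact: pack_blin. Qed.

Lemma contraction_opb : opb 1 (pack T).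
Proof. by apply: pack_opb => // f lf; rewrite mul1e; exact: T1. Qed.

Let C1 := contraction_opb.

Lemma dbr_op_codefect : pack (dbr_op T) = codefect (pack T) /\ bounded_linear (dbr_op T).
Proof.
apply: psqrt_oproot.
- by move=> x y; rewrite (dot_hadj _ _ Cb) (hadj_dot _ _ Cb).
- move=> x; apply: le_trans (C1 _) _; rewrite mul1r.
  by apply: (hadj_opb Cb ler01).
by move=> y; apply/funext => j; rewrite /= (adj_pack Tb) (packE Tb).
Qed.

Lemma dbr_lift_model f g : model_pair (pack T) f g ->
  dbr_lift (dbr_op T) f = model_lift (pack T) f g.
Proof.
move=> fg; have [pk Db] := dbr_op_codefect.
have DE (x : l2vec R J) : dbr_op T x = codefect (pack T) x by rewrite -packE// pk.
have [h1 h2] := model_liftP Cb C1 fg.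
have cl := codefect_lin Cb C1.
apply: xget_unique.
  split; first exact: l2valP.
    by rewrite DE h1.
  move=> k lk; rewrite -[k](to_l2vecK lk) DE inner_dot => k0; apply: h2.
  by apply: l2vec_ext => i; rewrite k0.
move=> y [ly Dy ky]; rewrite -[y](to_l2vecK ly); congr l2val.
have Dhy : codefect (pack T) (to_l2vec y) = f.
  by apply: l2vec_ext => i; rewrite -DE to_l2vecK// Dy.
set h := model_lift _ f g in h1 h2 *.
have k0 : codefect (pack T) (to_l2vec y - h) = 0 by rewrite (hlinB cl) Dhy h1 subrr.
apply/eqP; rewrite -subr_eq0; apply/eqP/nsq_eq0; rewrite nsqE dotBr (h2 _ k0) subr0.
rewrite -inner_dot to_l2vecK// ky//; first exact: l2valP.
by rewrite DE k0.
Qed.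

Lemma dbr_inner_model f g f' g' : model_pair (pack T) f g -> model_pair (pack T) f' g' ->
  dbr_inner T f f' = dot f f' + dot g g'.
Proof.
move=> fg fg'; rewrite /dbr_inner (dbr_lift_model fg) (dbr_lift_model fg') inner_dot.
exact: model_lift_dot.
Qed.

Lemma dbr_norm2_model f g : model_pair (pack T) f g ->
  dbr_norm2 T f = (nsq f + nsq g)%:E.
Proof.
move=> fg; rewrite /dbr_norm2 (dbr_lift_model fg) norm2_nsq.
by rewrite !nsqE (model_lift_dot Cb C1 fg fg) ReD.
Qed.

End RangeSpace.
Global Opaque defect codefect.

(** * Shifts *)

Section Pullback.
Context {R : realType} {I J : choiceType} (s : I -> J).
Hypothesis s_inj : injective s.

Lemma pull_l2 (x : l2vec R J) : (norm2 (fun i => x (s i)) <= (nsq x)%:E)%E.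
Proof.
apply: norm2_le_fin => t ut; rewrite -(big_map s xpredT (fun j => sqmod (x j))).
by apply: fin_le_nsq; rewrite map_inj_uniq.
Qed.

Definition pull (x : l2vec R J) : l2vec R I :=
  L2Vec (le_lt_trans (pull_l2 x) (ltry (nsq x))).

Lemma pullE x i : pull x i = x (s i). Proof. by []. Qed.

Lemma pull_opb : opb 1 pull.
Proof. by move=> x; rewrite mul1r -lee_fin -norm2_nsq; exact: pull_l2. Qed.

Lemma pull_blin : blin pull.
Proof. by split; [move=> a x y; apply: l2vec_ext | exists 1; exact: pull_opb]. Qed.

(** As the adjoint of [pull], this is transport along [s], extended by 0. *)
Definition push : l2vec R I -> l2vec R J := hadj pull.

Lemma push_blin : blin push. Proof. exact: hadj_blin pull_blin. Qed.

Lemma hadj_push : hadj push = pull. Proof. exact: hadjK pull_blin. Qed.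

Lemma pushE y j : push y j = dot (pull (basis_vec j)) y.
Proof. by rewrite -dot_delta (dot_hadj _ _ push_blin) hadj_push. Qed.

Lemma push_in y i : push y (s i) = y i.
Proof.
rewrite pushE -[RHS]dot_delta; congr (dot _ y); apply: l2vec_ext => i'.
by rewrite pullE !basis_vecE inj_eq.
Qed.

Lemma push_out y j : (forall i, s i <> j) -> push y j = 0.
Proof.
move=> sj; rewrite pushE (_ : pull _ = 0) ?dot0l//; apply: l2vec_ext => i.
by rewrite pullE basis_vecE; case: eqP => // /sj.
Qed.

Lemma pushK : cancel push pull.
Proof. by move=> y; apply: l2vec_ext => i; rewrite pullE push_in. Qed.

Lemma dot_push x y : dot (push x) (push y) = dot x y.
Proof. by rewrite (dot_hadj _ _ push_blin) hadj_push pushK. Qed.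

Lemma push_delta i : push (basis_vec i) = basis_vec (s i).
Proof.
apply: dot_ext => z; rewrite (dot_hadj _ _ push_blin) hadj_push.
by rewrite !dot_deltar.
Qed.

End Pullback.
Arguments pull {R I J s}.
Arguments push {R I J} s.

Lemma pull_push_disjoint {R : realType} {I I' J : choiceType} (s : I -> J) (t : I' -> J)
    (s_inj : injective s) (t_inj : injective t) (y : l2vec R I) :
  (forall i i', s i <> t i') -> pull t_inj (push s s_inj y) = 0.
Proof.
by move=> st; apply: l2vec_ext => i'; rewrite pullE push_out// => i; exact: st.
Qed.

(** [J] is the disjoint union of [Z] and of the ranges of the [s k]. *)
Lemma norm2_split {R : realType} {K J : choiceType} (s : K -> J -> J) (Z : set J)
    (f : vec R J) :
  (forall k k' j j', s k j = s k' j' -> k = k' /\ j = j') ->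
  (forall k j, ~ Z (s k j)) -> (forall j, ~ Z j -> exists k j', j = s k j') ->
  norm2 f = (\esum_(k in [set: K]) norm2 (fun j => f (s k j)) +
             \esum_(j in Z) (sqmod (f j))%:E)%E.
Proof.
move=> s_inj sZ Zs.
have pos j : (0 <= (sqmod (f j))%:E)%E by rewrite lee_fin sqmod_ge0.
rewrite [LHS](esumID (~` Z))// setCK !setTI; congr (_ + _)%E.
rewrite (_ : (fun k => norm2 _) =
    fun k => \esum_(j in [set: J]) (sqmod (f (s k j)))%:E)%E//.
rewrite esum_esum//.
rewrite (_ : [set: K] `*`` _ = [set: K * J]); last by apply/seteqP; split.
apply: (@reindex_esum _ _ _ _ _ (fun p => s p.1 p.2)); split.
- by move=> [k j] _; exact: sZ.
- by move=> [k j] [k' j'] _ _ /= /s_inj [-> ->].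
- by move=> j /Zs [k [j' ->]]; exists (k, j').
Qed.

(** * Contractions commuting with the shifts *)

Section LeftShifts.
Context {R : realType} {d : option nat}.
Local Notation H := (l2vec R (word d)).

Lemma cons_injl (k : letter d) : injective (fun w : word d => k :: w).
Proof. by move=> w w' []. Qed.
Arguments cons_injl : clear implicits.

Definition fshift k : H -> H := push (fun w : word d => k :: w) (cons_injl k).
Definition fshift' k : H -> H := pull (cons_injl k).

(** The constant series 1. *)
Definition vacuum : H := basis_vec ([::] : word d).

Lemma fshift_blin k : blin (fshift k). Proof. exact: push_blin. Qed.
Lemma fshift'_blin k : blin (fshift' k). Proof. exact: pull_blin. Qed.
Lemma hadj_fshift k : hadj (fshift k) = fshift' k. Proof. exact: hadj_push. Qed.
Lemma fshift'E k (x : H) w : fshift' k x w = x (k :: w). Proof. by []. Qed.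

Lemma fshift_cons k (x : H) w : fshift k x (k :: w) = x w.
Proof. exact: (push_in (cons_injl k)). Qed.

Lemma fshift_nil k (x : H) : fshift k x [::] = 0.
Proof. by rewrite push_out. Qed.

Lemma fshift_cons_neq k j (x : H) w : j != k -> fshift k x (j :: w) = 0.
Proof. by move=> /eqP jk; rewrite push_out// => w' [/esym]. Qed.

Lemma fshift'K j k (x : H) : fshift' j (fshift k x) = if j == k then x else 0.
Proof.
case: (j =P k) => [->|jk]; first exact: pushK.
by apply: pull_push_disjoint => w w' [/esym].
Qed.

Lemma fshift'_vacuum k : fshift' k vacuum = 0.
Proof. by apply: l2vec_ext. Qed.

Lemma fshift_delta k (w : word d) : fshift k (basis_vec w) = basis_vec (k :: w : word d).
Proof. exact: push_delta. Qed.

End LeftShifts.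

Section ToeplitzDefect.
Context {R : realType} {d : option nat} {J : choiceType} (s : letter d -> J -> J).
Local Notation H := (l2vec R (word d)).
Hypothesis s_inj : forall k k' j j', s k j = s k' j' -> k = k' /\ j = j'.

Lemma s_inj1 k : injective (s k). Proof. by move=> j j' /s_inj []. Qed.
Arguments s_inj1 : clear implicits.

Variable C : H -> l2vec R J.
Hypothesis Cb : blin C.
Hypothesis C1 : opb 1 C.
Hypothesis CL : forall k x, C (fshift k x) = push (s k) (s_inj1 k) (C x).

Local Notation S' k := (pull (s_inj1 k)).
Local Notation D := (defect C).
Local Notation K := (defect_space C).

Let Db : blin D. Proof. exact: defect_blin. Qed.
Let Dl : hlin D. Proof. exact: defect_lin. Qed.
Let Dsa : adjoint D D. Proof. exact: defect_adjoint. Qed.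

Lemma defect_space0 : K 0. Proof. by move=> k _; rewrite dot0r. Qed.

Lemma defect_spaceZ a x : K x -> K (a *: x).
Proof. by move=> xK k k0; rewrite dotZr xK// mulr0. Qed.

Lemma defect_spaceB x y : K x -> K y -> K (x - y).
Proof. by move=> xK yK k k0; rewrite dotBr xK// yK// subrr. Qed.

Lemma defect_space_defect x : K (D x).
Proof. by move=> k k0; rewrite Dsa k0 dot0l. Qed.

Lemma defect_space_eq x y : K x -> K y -> D x = D y -> x = y.
Proof.
move=> xK yK e; apply/eqP; rewrite -subr_eq0; apply/eqP/nsq_eq0; rewrite nsqE.
by rewrite defect_spaceB// (hlinB Dl) e subrr.
Qed.

Lemma hadj_pull k y : hadj C (S' k y) = fshift' k (hadj C y).
Proof.
apply: dot_ext => x; rewrite -(hadj_dot _ _ Cb) -hadj_fshift.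
rewrite -(hadj_dot _ _ (fshift_blin k)) -(hadj_dot _ _ Cb) CL.
by rewrite -(hadj_push (s_inj1 k)) -(hadj_dot _ _ (push_blin _)).
Qed.

Lemma fshift'_gram j k x : fshift' j (hadj C (C (fshift k x))) =
  if j == k then hadj C (C x) else 0.
Proof.
rewrite -hadj_pull CL; case: (j =P k) => [->|jk]; first by rewrite pushK.
rewrite pull_push_disjoint; first exact: hlin0 (hadj_blin Cb).1.
by move=> i i' /s_inj [/esym /jk].
Qed.

(** The square of the defect operator is left Toeplitz, since [C] commutes with the shifts. *)
Lemma fshift'_defect2 j k x : fshift' j (D (D (fshift k x))) = if j == k then D (D x) else 0.
Proof.
rewrite !(defectK Cb C1) (hlinB (fshift'_blin j).1) fshift'K fshift'_gram.
by case: (j =P k); rewrite ?subrr.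
Qed.

(** The isometry [D x |-> D (L_k x)] of the closed range of [D], extended by 0;
    [V_k] in the comments below. *)
Definition is_wold (V : H -> H) k :=
  [/\ blin V, forall x, V (D x) = D (fshift k x) & forall y, K (hadj V y)].

Lemma wold_exists k : exists V, is_wold V k.
Proof.
have le x : nsq ((D \o fshift k) x) <= 1 * nsq (D x).
  rewrite mul1r /= !(nsq_defect Cb C1) CL.
  by rewrite !nsqE /fshift !dot_push.
have [V [Vb _ VD VK]] := douglas Db (blin_comp Db (fshift_blin k)) ler01 le.
by exists V; split=> // y g g0; apply: VK; rewrite (hadj_defect Cb C1).
Qed.

Definition wold k : H -> H := xget (fun=> 0) [set V | is_wold V k].

Lemma woldP k : is_wold (wold k) k.
Proof. exact: (xgetPex (fun=> 0) (wold_exists k)). Qed.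

Opaque wold.

Lemma wold_blin k : blin (wold k). Proof. by case: (woldP k). Qed.
Lemma wold_defect k x : wold k (D x) = D (fshift k x). Proof. by case: (woldP k). Qed.

Definition wold' k : H -> H := hadj (wold k).

Lemma wold'_blin k : blin (wold' k). Proof. exact: hadj_blin (wold_blin k). Qed.
Lemma wold'_space k y : K (wold' k y). Proof. by case: (woldP k) => _ _; exact. Qed.

Lemma defect_wold' k y : D (wold' k y) = fshift' k (D y).
Proof.
apply: dot_extl => x; rewrite -Dsa -(dot_hadj _ _ (wold_blin k)) wold_defect Dsa.
by rewrite (dot_hadj _ _ (fshift_blin k)) hadj_fshift.
Qed.

Lemma wold_space k y : K (wold k y).
Proof.
move=> g g0; rewrite (dot_hadj _ _ (wold_blin k)) -/(wold' k).
rewrite (_ : wold' k g = 0) ?dot0l//.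
apply: defect_space_eq; [exact: wold'_space|exact: defect_space0|].
by rewrite defect_wold' g0 (hlin0 Dl) (hlin0 (fshift'_blin k).1).
Qed.

Lemma wold'_defect j k x : wold' j (D (fshift k x)) = if j == k then D x else 0.
Proof.
apply: defect_space_eq; first exact: wold'_space.
  by case: ifP => _; [exact: defect_space_defect|exact: defect_space0].
by rewrite defect_wold' fshift'_defect2; case: ifP; rewrite ?(hlin0 Dl).
Qed.

Lemma wold'K j k y : K y -> wold' j (wold k y) = if j == k then y else 0.
Proof.
move=> yK; apply: defect_space_eq; first exact: wold'_space.
  by case: ifP => _ //; exact: defect_space0.
apply: dot_extl => x; rewrite -!Dsa -(dot_hadj _ _ (wold_blin j)) wold_defect.
rewrite (hadj_dot _ _ (wold_blin k)) -/(wold' k) wold'_defect eq_sym.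
by case: ifP; rewrite ?dot0r ?dot0l.
Qed.

(** [C' S_k' C 1 + D V_k' D 1 = L_k' (C' C 1 + D^2 1) = L_k' 1 = 0], the prime being
    the adjoint. *)
Lemma model_pair_pull k : model_pair C (S' k (C vacuum)) (wold' k (D vacuum)).
Proof.
split; last exact: wold'_space.
rewrite hadj_pull defect_wold' -(hlinD (fshift'_blin k).1) (defectK Cb C1).
by rewrite addrC subrK fshift'_vacuum.
Qed.

Definition fsupp (x : H) := finite_set [set w | x w != 0].

(** A polynomial involves finitely many letters, even over an infinite alphabet. *)
Lemma fsupp_decomp (x : H) : fsupp x -> exists2 t : seq (letter d), uniq t &
  x = x [::] *: vacuum + \sum_(k <- t) fshift k (fshift' k x).
Proof.
move=> /finite_seqP [t Ht].
pose heads := undup (pmap ohead t); exists heads; first exact: undup_uniq.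
have sumE (u : seq (letter d)) (f : letter d -> H) w :
    (\sum_(k <- u) f k) w = \sum_(k <- u) f k w.
  by elim: u => [|k u IH]; rewrite ?big_nil ?big_cons// l2valD IH.
apply: l2vec_ext => w; rewrite l2valD l2valZ sumE; case: w => [|j w].
  rewrite basis_vecE eqxx mulr1 big1 ?addr0// => k _; exact: fshift_nil.
rewrite basis_vecE mulr0 add0r.
have [jh|jh] := boolP (j \in heads).
  rewrite (bigD1_seq j)//=; last exact: undup_uniq.
  rewrite fshift_cons fshift'E big1 ?addr0// => k kj.
  by rewrite fshift_cons_neq// eq_sym.
have -> : x (j :: w) = 0.
  apply/eqP; move: jh; apply: contraNT => x0.
  rewrite mem_undup mem_pmap; apply/mapP; exists (j :: w) => //.
  by have : [set w | x w != 0] (j :: w) by []; rewrite Ht.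
rewrite big_seq big1// => k kh; apply: fshift_cons_neq.
by apply: contraNneq jh => ->.
Qed.

(** [v - sum_(k in t) V_k V_k' v], with [v = D 1] and [V_k'] the adjoint of [V_k], is
    the component of [v] orthogonal to the ranges of finitely many [V_k]. Its squared
    norm is [|v|^2 - sum_(k in t) |V_k' v|^2]. It is at most [|D p|^2] for a polynomial
    [p] with constant term 1 and first letters in [t], because [D p - v] is then a sum
    of vectors in those ranges. *)
Lemma esum_wold' (beta : R) :
  (forall t : seq (letter d), uniq t ->
     beta <= nsq (D vacuum - \sum_(k <- t) wold k (wold' k (D vacuum)))) ->
  (forall e, 0 < e -> exists p : H, [/\ fsupp p, p [::] = 1 & nsq (D p) < beta + e]) ->
  esumT (fun k => nsq (wold' k (D vacuum))) = (nsq (D vacuum) - beta)%:E.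
Proof.
move=> lower upper; have [v vE] : exists v, v = D vacuum by exists (D vacuum).
rewrite -vE in lower *.
pose proj t := \sum_(k <- t) wold k (wold' k v).
have wold'_proj (t : seq (letter d)) k : uniq t -> k \in t -> wold' k (proj t) = wold' k v.
  move=> ut kt; rewrite (hlin_sum (wold'_blin k).1).
  have e i : wold' k (wold i (wold' i v)) = if k == i then wold' k v else 0.
    by rewrite (wold'K _ _ (wold'_space _ _)); case: (k =P i) => [->|].
  rewrite (eq_bigr _ (fun i _ => e i)); move: (wold' k v) => x.
  rewrite (bigD1_seq k kt ut) /= eqxx big1 ?addr0// => i ik.
  by rewrite eq_sym (negbTE ik).
have nsq_proj t : uniq t -> nsq (v - proj t) = nsq v - \sum_(k <- t) nsq (wold' k v).
  move=> ut.
  have vp y : (forall k, k \in t -> wold' k y = wold' k v) ->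
      dot y (proj t) = (\sum_(k <- t) nsq (wold' k v))%:C.
    move=> yv; rewrite dot_sumr rmorph_sum; apply: eq_big_seq => k kt.
    by rewrite (dot_hadj _ _ (wold_blin k)) -/(wold' k) yv// dotxx.
  rewrite nsqB (vp v)// (nsqE (proj t)) (vp (proj t)); last by move=> k kt; exact: wold'_proj.
  by move=> /=; ring.
apply/eqP; rewrite eq_le; apply/andP; split.
  by apply: esumT_le_fin => t ut; have := lower t ut; rewrite -/(proj t) nsq_proj//; lra.
apply/lee_addgt0Pr => e e0; have [p [pf p1 pe]] := upper _ e0.
have [t ut pE] := fsupp_decomp pf.
suff : nsq v - beta <= \sum_(k <- t) nsq (wold' k v) + e.
  rewrite -lee_fin => /le_trans; apply; rewrite EFinD; apply: leeD => //.
  exact: fin_le_esumT.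
pose z := \sum_(k <- t) wold k (D (fshift' k p)).
have DpE : D p = (v - proj t) + (proj t + z).
  rewrite addrA subrK {1}pE p1 scale1r (hlinD Dl) -vE (hlin_sum Dl); congr (_ + _).
  by apply: eq_bigr => k _; rewrite wold_defect.
have orth : dot (v - proj t) (proj t + z) = 0.
  rewrite dotDr !dot_sumr !big_seq !big1 ?addr0// => k kt;
    rewrite (dot_hadj _ _ (wold_blin k)) -/(wold' k) (hlinB (wold'_blin k).1) wold'_proj//;
    by rewrite subrr dot0l.
have := nsq_proj _ ut; move: pe; rewrite DpE nsqD orth mulr0 addr0.
have := nsq_ge0 (proj t + z); lra.
Qed.

End ToeplitzDefect.

(** * Analysis operator of an orthonormal family *)

Section Orthonormal.
Context {R : realType} {I J : choiceType} (e : I -> l2vec R J).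
Hypothesis e_on : forall i j, dot (e i) (e j) = (i == j)%:R.

Lemma bessel_fin (t : seq I) (y : l2vec R J) : uniq t ->
  \sum_(i <- t) sqmod (dot (e i) y) <= nsq y.
Proof.
move=> ut.
pose z := \sum_(i <- t) dot (e i) y *: e i.
have ez i : i \in t -> dot (e i) z = dot (e i) y.
  move=> it; rewrite dot_sumr.
  have h j : dot (e i) (dot (e j) y *: e j) = if i == j then dot (e i) y else 0.
    by rewrite dotZr e_on; case: (i =P j) => [->|_]; rewrite ?mulr1 ?mulr0.
  rewrite (eq_bigr _ (fun j _ => h j)) (bigD1_seq i it ut) /= eqxx big1 ?addr0// => j ji.
  by rewrite eq_sym (negbTE ji).
have vp x : (forall i, i \in t -> dot (e i) x = dot (e i) y) ->
    dot x z = (\sum_(i <- t) sqmod (dot (e i) y))%:C.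
  move=> xy; rewrite dot_sumr rmorph_sum; apply: eq_big_seq => i it.
  by rewrite dotZr -(dotJ (e i) x) xy// mulrC mulJc.
have := nsq_ge0 (y - z).
rewrite nsqB (vp y)// (nsqE z) (vp z) /=; last by move=> i; exact: ez.
lra.
Qed.

Definition analysis (y : l2vec R J) : l2vec R I :=
  L2Vec (le_lt_trans (norm2_le_fin (fun t ut => bessel_fin y ut)) (ltry (nsq y))).

Lemma analysisE y i : analysis y i = dot (e i) y. Proof. by []. Qed.

Lemma analysis_opb : opb 1 analysis.
Proof.
move=> y; rewrite mul1r -lee_fin -norm2_nsq; apply: norm2_le_fin => t ut.
exact: bessel_fin.
Qed.

Lemma analysis_blin : blin analysis.
Proof.
split; last by exists 1; exact: analysis_opb.
by move=> a x y; apply: l2vec_ext => i; rewrite l2valD l2valZ !analysisE dotDr dotZr.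
Qed.

Lemma hadj_analysis_delta i : hadj analysis (basis_vec i) = e i.
Proof.
by apply: dot_extl => z; rewrite -(dot_hadj _ _ analysis_blin) dot_delta analysisE.
Qed.

Lemma hadj_analysisK x : analysis (hadj analysis x) = x.
Proof.
pose f := analysis \o hadj analysis.
have fb : blin f by exact: blin_comp analysis_blin (hadj_blin analysis_blin).
suff fid : f = id by rewrite -[LHS]/(f x) fid.
apply: blin_delta_ext => //; first exact: blin_id.
move=> i; apply: l2vec_ext => j.
by rewrite -[LHS]/(dot (e j) (hadj analysis (basis_vec i))) hadj_analysis_delta e_on basis_vecE.
Qed.

End Orthonormal.

Lemma dense_range {R : realType} {I J : choiceType} (A : l2vec R I -> l2vec R J) :
  blin A -> (forall y, hadj A y = 0 -> y = 0) ->
  forall g e, 0 < e -> exists x, nsq (g - A x) < e.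
Proof.
move=> Ab Aker g e e0; have [Al _] := Ab.
have [||||||g' [Hg clos _]] := @riesz_minimum R I J (fun=> True) A (fun x => dot g (A x)) (nsq g) => //.
- by move=> a x y; rewrite Al dotDr dotZr.
- exact: nsq_ge0.
- by move=> x _; exact: CauchySchwarz.
have [x _ Hx] := clos e e0; exists x.
suff -> : g = g' by [].
apply/eqP; rewrite -subr_eq0; apply/eqP; apply: Aker; apply: dot_extl => z.
by rewrite -(dot_hadj _ _ Ab) dotBl Hg// subrr dot0l.
Qed.

(** * The Wold decomposition *)

Section WoldDecomposition.
Context {R : realType} {d : option nat} {J : choiceType} (s : letter d -> J -> J).
Local Notation H := (l2vec R (word d)).
Hypothesis s_inj : forall k k' j j', s k j = s k' j' -> k = k' /\ j = j'.
Variable C : H -> l2vec R J.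
Hypothesis Cb : blin C.
Hypothesis C1 : opb 1 C.
Hypothesis CL : forall k x, C (fshift k x) = push (s k) (@s_inj1 d J s s_inj k) (C x).

Local Notation D := (defect C).
Local Notation K := (defect_space C).
Local Notation V k := (wold C k).
Local Notation V' k := (wold' C k).

Let Db : blin D. Proof. exact: defect_blin. Qed.
Let Dl : hlin D. Proof. exact: defect_lin. Qed.
Let Dsa : adjoint D D. Proof. exact: defect_adjoint. Qed.
Let Vb k : blin (V k). Proof. exact: wold_blin Cb C1 CL k. Qed.
Let V'b k : blin (V' k). Proof. exact: wold'_blin Cb C1 CL k. Qed.
Let V'K k y : K (V' k y). Proof. exact: wold'_space Cb C1 CL k y. Qed.
Let VK k y : K (V k y). Proof. exact: wold_space Cb C1 CL k y. Qed.
Let V'V j k y : K y -> V' j (V k y) = if j == k then y else 0.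
Proof. exact: wold'K Cb C1 CL j k y. Qed.

Lemma fsupp0 : fsupp (0 : H).
Proof. by apply: (@sub_finite_set _ _ set0) => // w /=; rewrite eqxx. Qed.

Lemma fsupp_lin a (x y : H) : fsupp x -> fsupp y -> fsupp (a *: x + y).
Proof.
move=> fx fy; apply: (@sub_finite_set _ _ ([set w | x w != 0] `|` [set w | y w != 0])).
  move=> w /=; have [->|x0] := eqVneq (x w) 0; last by left.
  by rewrite mulr0 add0r; right.
by rewrite finite_setU.
Qed.

Lemma fsupp_delta w : fsupp (basis_vec w : H).
Proof.
apply: (@sub_finite_set _ _ [set w]) => // w' /=; rewrite /basis_fun.
by case: (w' =P w) => // _; rewrite eqxx.
Qed.

Lemma dot_vacuum (x : H) : dot (vacuum : H) x = x [::].
Proof. exact: dot_delta. Qed.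

(** [u] represents [D x |-> x(0)] in the closure of [D] applied to polynomials. *)
Lemma defect_vacuum_root (c : R) : 0 <= c -> (forall x : H, sqmod (x [::]) <= c * nsq (D x)) ->
  exists u, [/\ K u, D u = vacuum &
    forall e, 0 < e -> exists2 p, fsupp p & nsq (u - D p) < e].
Proof.
move=> c0 le.
have [||||||u [Hu clos _]] := @riesz_minimum R _ _ fsupp D (fun x : H => x [::]) c => //.
- exact: fsupp0.
- by move=> a x y; exact: fsupp_lin.
exists u; split=> //.
  by move=> k k0; apply: closure_range_orth Db _ clos; rewrite (hadj_defect Cb C1).
apply: l2vec_ext => w; rewrite -[LHS]dot_delta Dsa -dotJ Hu; last exact: fsupp_delta.
by rewrite !basis_vecE eq_sym; case: eqP => _; rewrite ?conjc1 ?conjc0.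
Qed.

(* [alpha^2 u] is the component of [D 1] orthogonal to [D x] for all [x] without
   constant term, and [alpha] is its norm. *)
Variables (u : H) (alpha : R).
Hypothesis uK : K u.
Hypothesis Du : D u = vacuum.
Hypothesis u_approx : forall e, 0 < e -> exists2 p, fsupp p & nsq (u - D p) < e.
Hypothesis alpha0 : 0 < alpha.
Hypothesis alphaE : alpha ^+ 2 * nsq u = 1.

Lemma dot_root (x : H) : dot u (D x) = x [::].
Proof. by rewrite Dsa Du dot_vacuum. Qed.

Lemma wold'_root k : V' k u = 0.
Proof.
apply: (defect_space_eq Cb C1 (V'K _ _)); first exact: defect_space0.
by rewrite (defect_wold' Cb C1 CL) Du fshift'_vacuum (hlin0 Dl).
Qed.

Lemma defect_lower (x : H) : x [::] = 1 -> alpha ^+ 2 <= nsq (D x).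
Proof.
move=> x1; have := CauchySchwarz u (D x); rewrite dot_root x1 sqmod1.
have := alphaE; have := sqr_ge0 alpha; nra.
Qed.

(** Correcting the constant term of an approximation [D p] of [u], and dividing by
    [|u|^2], gives an almost optimal polynomial. *)
Lemma defect_upper e : 0 < e ->
  exists p : H, [/\ fsupp p, p [::] = 1 & nsq (D p) < alpha ^+ 2 + e].
Proof.
move=> e0; set N := nsq u.
have aE : alpha ^+ 2 * N = 1 by exact: alphaE.
have N0 : 0 < N by have := nsq_ge0 u; rewrite -/N; have := sqr_ge0 alpha; nra.
pose v := nsq (D (vacuum : H)); have v0 : 0 <= v by exact: nsq_ge0.
have M0 : 0 < 2 * (1 + N * v) by have := mulr_ge0 (ltW N0) v0; lra.
have eta0 : 0 < e * N ^+ 2 / (2 * (1 + N * v)) by rewrite divr_gt0// mulr_gt0// exprn_gt0.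
have [p pf pe] := u_approx eta0.
pose q := (N%:C - p [::]) *: vacuum + p.
have q1 : q [::] = N%:C by rewrite l2valD l2valZ basis_vecE eqxx mulr1 subrK.
have pN : sqmod (N%:C - p [::]) <= N * nsq (u - D p).
  by have := CauchySchwarz u (u - D p); rewrite dotBr dotxx dot_root.
have qe : nsq (u - D q) < e * N ^+ 2.
  have -> : u - D q = (u - D p) - (N%:C - p [::]) *: D vacuum.
    by rewrite /q Dl opprD addrCA addrC.
  have := nsqD_le (u - D p) (- ((N%:C - p [::]) *: D vacuum)).
  rewrite nsqN nsqZ -/v => h1.
  have h2 : sqmod (N%:C - p [::]) * v <= N * nsq (u - D p) * v by exact: ler_wpM2r.
  move: pe; rewrite ltr_pdivlMr//; move: (nsq (u - D p)) h1 h2 => m; lra.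
have qD : nsq (D q) < N + e * N ^+ 2.
  by move: qe; rewrite nsqB dot_root q1 -/N /=; lra.
exists ((N^-1)%:C *: q); split.
- by rewrite -[_ *: q]addr0; apply: fsupp_lin fsupp0; apply: fsupp_lin pf; exact: fsupp_delta.
- by rewrite l2valZ q1 -rmorphM /= mulVf ?gt_eqF.
rewrite (hlinZ Dl) nsqZ sqmodC.
have -> : alpha ^+ 2 + e = N^-1 ^+ 2 * (N + e * N ^+ 2).
  have -> : alpha ^+ 2 = N^-1 by rewrite -[RHS]mul1r -aE mulfK ?gt_eqF.
  by field; rewrite gt_eqF.
by rewrite ltr_pM2l// exprn_gt0// invr_gt0.
Qed.

Lemma esum_wold'_root :
  esumT (fun k => nsq (V' k (D vacuum))) = (nsq (D vacuum) - alpha ^+ 2)%:E.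
Proof.
apply: (esum_wold' Cb C1 CL); last exact: defect_upper.
move=> t ut; set y := _ - _.
have uy : dot u y = 1.
  rewrite /y dotBr dot_root basis_vecE eqxx.
  have -> : dot u (\sum_(k <- t) V k (V' k (D vacuum))) = 0; last by rewrite subr0.
  elim: t {ut y} => [|k t IH]; first by rewrite big_nil dot0r.
  rewrite big_cons dotDr IH addr0 (dot_hadj _ _ (Vb k)) -/(wold' C k).
  by rewrite wold'_root dot0l.
have := CauchySchwarz u y; rewrite uy sqmod1; have := alphaE; have := sqr_ge0 alpha; nra.
Qed.

(** Up to the factor [alpha], an orthonormal basis of the shift part of the Wold
    decomposition. *)
Definition wvec (w : word d) : H := foldr (fun k y => V k y) u w.

Lemma wvec_space w : K (wvec w).
Proof. by case: w => [|k w] /=; [exact: uK|exact: VK]. Qed.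

Lemma dot_wvec w w' : dot (wvec w) (wvec w') = if w == w' then (nsq u)%:C else 0.
Proof.
have l0 k y : dot u (V k y) = 0.
  by rewrite (dot_hadj _ _ (Vb k)) -/(wold' C k) wold'_root dot0l.
elim: w w' => [|k w IH] [|k' w'] /=.
- by rewrite dotxx.
- by rewrite l0.
- by rewrite -dotJ l0 conjc0.
rewrite (hadj_dot _ _ (Vb k)) -/(wold' C k) (V'V _ _ (wvec_space w')) eqseq_cons.
by case: (k == k') => /=; rewrite ?IH ?dot0r.
Qed.

Definition wbasis w : H := alpha%:C *: wvec w.

Lemma wbasis_on w w' : dot (wbasis w) (wbasis w') = (w == w')%:R.
Proof.
rewrite /wbasis dotZl dotZr dot_wvec conjc_real mulrA; case: eqP => _; last by rewrite mulr0.
by rewrite -!rmorphM -expr2 alphaE.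
Qed.

Definition wana : H -> H := analysis wbasis_on.
Let wana_b : blin wana. Proof. exact: analysis_blin. Qed.

Lemma wanaE y w : wana y w = alpha%:C * dot (wvec w) y.
Proof. by rewrite analysisE dotZl conjc_real. Qed.

Lemma wana_wold k y : K y -> wana (V k y) = fshift k (wana y).
Proof.
move=> yK; apply: l2vec_ext => -[|j w]; rewrite wanaE /=.
  by rewrite fshift_nil (dot_hadj _ _ (Vb k)) -/(wold' C k) wold'_root dot0l mulr0.
rewrite (hadj_dot _ _ (Vb j)) -/(wold' C j) V'V//; case: (j =P k) => [->|/eqP jk].
  by rewrite fshift_cons wanaE.
by rewrite fshift_cons_neq// dot0r mulr0.
Qed.

(** Expansion of [D x] along the shift part. It commutes with the shifts, so it is a
    right multiplication. *)
Definition outer_factor : H -> H := wana \o D.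

Lemma outer_factor_blin : blin outer_factor. Proof. exact: blin_comp. Qed.

Lemma outer_factor_fshift k x : outer_factor (fshift k x) = fshift k (outer_factor x).
Proof.
rewrite /outer_factor /= -(wold_defect Cb C1 CL) wana_wold//.
exact: defect_space_defect.
Qed.

Lemma outer_factor_le x : nsq (outer_factor x) <= nsq (D x).
Proof. by have := analysis_opb wbasis_on (D x); rewrite mul1r. Qed.

Lemma commutant_ext (F G : H -> H) : blin F -> blin G ->
  (forall k x, F (fshift k x) = fshift k (F x)) ->
  (forall k x, G (fshift k x) = fshift k (G x)) ->
  F vacuum = G vacuum -> F = G.
Proof.
move=> Fb Gb FL GL e; apply: blin_delta_ext => //; elim=> [//|k w IH].
by rewrite -fshift_delta FL GL IH.
Qed.

(** The adjoint is [D] composed with an isometry into the closed range of [D], on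
    which [D] is injective. *)
Lemma outer_factor_ker y : hadj outer_factor y = 0 -> y = 0.
Proof.
rewrite hadj_comp// (hadj_defect Cb C1) /= => e.
suff z : hadj wana y = 0.
  by rewrite -[y](hadj_analysisK wbasis_on) -/wana z; exact: hlin0 wana_b.1.
apply: (defect_space_eq Cb C1) => //; last by rewrite (hlin0 Dl).
  move=> k k0; rewrite -(hadj_dot _ _ wana_b) (_ : wana k = 0) ?dot0l//.
  by apply: l2vec_ext => w; rewrite wanaE -dotJ (wvec_space w k0) conjc0 mulr0.
exact: defect_space0.
Qed.

(** The condition says that [D y] is constant, and [u] is the only solution of
    [D u = 1]. *)
Lemma wandering_line y : K y -> (forall k, V' k y = 0) -> y = D y [::] *: u.
Proof.
move=> yK y0; apply: (defect_space_eq Cb C1) => //; first exact: defect_spaceZ.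
rewrite (hlinZ Dl) Du; apply: l2vec_ext => -[|k w]; rewrite l2valZ basis_vecE.
  by rewrite eqxx mulr1.
by rewrite mulr0 -fshift'E -(defect_wold' Cb C1 CL) y0 (hlin0 Dl).
Qed.

(** Write [G = F D] with [F] a contraction that commutes with the shifts. By induction
    on [w], the adjoint of [F] maps the basis vector at [w] into the span of the
    [wvec]: for a longer word it differs from a shifted vector of the span by a
    multiple of [u]. So [F] vanishes on the part orthogonal to the [wvec], and
    [G x] only sees [outer_factor x]. *)
Lemma outer_factor_maximal (G : H -> H) : blin G ->
  (forall k x, G (fshift k x) = fshift k (G x)) ->
  (forall x, nsq (G x) <= nsq (D x)) ->
  forall x, nsq (G x) <= nsq (outer_factor x).
Proof.
move=> Gb GL Gle x.
have le y : nsq (G y) <= 1 * nsq (D y) by rewrite mul1r.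
have [F [Fb F1 FD FK]] := douglas Db Gb ler01 le.
have F'K y : K (hadj F y) by move=> k k0; apply: FK; rewrite (hadj_defect Cb C1).
have K_ext y z : K y -> K z -> (forall x, dot y (D x) = dot z (D x)) -> y = z.
  move=> yK zK e; apply: (defect_space_eq Cb C1) => //; apply: dot_extl => t.
  by rewrite -!Dsa.
(* [F V_j = L_j F] on the closed range of [D], read on adjoints. *)
have V'F j z : V' j (hadj F z) = hadj F (fshift' j z).
  apply: K_ext => // t; rewrite -(dot_hadj _ _ (Vb j)) (wold_defect Cb C1 CL).
  rewrite -!(dot_hadj _ _ Fb) !FD GL (dot_hadj _ _ (fshift_blin j)).
  by rewrite hadj_fshift.
have F'l : hlin (hadj F) by exact: (hadj_blin Fb).1.
have F'delta w y : (forall w', dot (wvec w') y = 0) -> dot (hadj F (basis_vec w)) y = 0.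
  elim: w y => [|k w IH] y y0.
    rewrite (@wandering_line (hadj F (basis_vec [::])))//.
      by rewrite dotZl (y0 [::]) mulr0.
    by move=> k; rewrite V'F fshift'_vacuum (hlin0 F'l).
  pose z := hadj F (basis_vec (k :: w : word d)) - V k (hadj F (basis_vec w)).
  have zu : z = D z [::] *: u.
    apply: wandering_line; first exact: defect_spaceB.
    move=> j; rewrite (hlinB (V'b j).1) V'F V'V// -fshift_delta fshift'K.
    by case: (j == k); rewrite ?(hlin0 F'l) subrr.
  rewrite (_ : hadj F _ = z + V k (hadj F (basis_vec w))); last by rewrite subrK.
  rewrite dotDl zu dotZl (y0 [::]) mulr0 add0r (hadj_dot _ _ (Vb k)).
  by apply: IH => w'; rewrite -(hadj_dot _ _ (Vb k)); exact: (y0 (k :: w')).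
pose y := D x - hadj wana (outer_factor x).
have y0 w : dot (wvec w) y = 0.
  have : wana y w = 0.
    suff -> : wana y = 0 by [].
    rewrite /y (hlinB wana_b.1).
    by have /= := hadj_analysisK wbasis_on (outer_factor x); rewrite -/wana => ->; exact: subrr.
  rewrite wanaE => /eqP; rewrite mulf_eq0 => /orP [|/eqP//].
  by rewrite (inj_eq (@complexI R) _ 0) gt_eqF.
have Fy : F y = 0.
  by apply: l2vec_ext => w; rewrite -dot_delta (dot_hadj _ _ Fb) F'delta.
rewrite -FD (_ : D x = y + hadj wana (outer_factor x)); last by rewrite subrK.
rewrite (hlinD Fb.1) Fy add0r; apply: le_trans (F1 _) _; rewrite mul1r.
have := hadj_opb wana_b ler01 (analysis_opb wbasis_on) (outer_factor x).
by rewrite mul1r.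
Qed.

(** ** The Sarason coefficients *)

(** [D u = 1] is what puts [C 1] in the range space. *)
Lemma model_pair_vacuum : model_pair C (C vacuum) (D vacuum - u).
Proof.
split; last by apply: defect_spaceB => //; exact: defect_space_defect.
by rewrite (hlinB Dl) (defectK Cb C1) Du [vacuum - _]addrC addrK subrr.
Qed.

Lemma model_pair_step k f g : model_pair C f g ->
  model_pair C (pull (@s_inj1 d J s s_inj k) f) (V' k g).
Proof.
move=> [fg gK]; split; last exact: V'K.
rewrite (hadj_pull Cb CL) (defect_wold' Cb C1 CL) -(hlinD (fshift'_blin k).1) fg.
exact: hlin0 (fshift'_blin k).1.
Qed.

Definition backward_pull (w : word d) : l2vec R J :=
  foldr (fun k f => pull (@s_inj1 d J s s_inj k) f) (C vacuum) w.

Definition backward_wold (w : word d) : H :=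
  foldr (fun k g => V' k g) (D vacuum - u) w.

Lemma model_pair_backward w : model_pair C (backward_pull w) (backward_wold w).
Proof.
elim: w => [|k w IH]; first exact: model_pair_vacuum.
exact: model_pair_step.
Qed.

(** Membership in the model cancels everything but [- <u, V' v>], where [V'] is a
    product of adjoints of the [V_k]; moving it to the left side produces a [wvec],
    which is orthogonal to [u] as [w] is not empty. *)
Lemma sarason_coefficient w : w != [::] ->
  - (alpha%:C * (dot (C vacuum) (backward_pull w) + dot (D vacuum - u) (backward_wold w))) =
  outer_factor vacuum (rev w).
Proof.
move=> w0; have [mp _] := model_pair_backward w.
have -> : dot (D vacuum - u) (backward_wold w) =
    dot vacuum (D (backward_wold w)) - dot u (backward_wold w) by rewrite dotBl Dsa.
rewrite addrA (hadj_dot _ _ Cb) -dotDr mp dot0r sub0r mulrN opprK.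
rewrite [RHS]wanaE; congr (_ * _).
have shift x y t : dot x (foldr (fun k g => V' k g) y t) =
    dot (foldr (fun k g => V k g) x (rev t)) y.
  elim: t x => [//|k t IH] x /=.
  by rewrite rev_cons foldr_rcons -IH (hadj_dot _ _ (Vb k)).
have u0 : dot (wvec (rev w)) u = 0.
  have := dot_wvec (rev w) [::].
  by rewrite -[rev w == _]size_eq0 size_rev size_eq0 (negbTE w0).
by rewrite shift -/(wvec (rev w)) dotBr u0 subr0.
Qed.

Lemma outer_factor_vacuum_nil : outer_factor vacuum [::] = alpha%:C.
Proof. by rewrite wanaE dot_root basis_vecE eqxx mulr1. Qed.

End WoldDecomposition.

(** * Multiplication operators on the full Fock space *)

Section Multiplication.
Context {R : realType} {d : option nat}.
Local Notation H := (l2vec R (word d)).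
Implicit Types (F : series R d) (f g h : vec R (word d)).

Lemma bounded_linear_ext {I J : choiceType} (S T : op R I J) :
  (forall f : vec R I, l2 f -> S f = T f) -> bounded_linear S -> bounded_linear T.
Proof.
move=> e [[M SM] Sl]; split; first by exists M => f lf; rewrite -e//; exact: SM.
by move=> z x y lx ly; rewrite -!e//; [exact: Sl | apply: l2D => //; exact: l2Z].
Qed.

Lemma L_fshift (k : letter d) (x : H) : L k x = fshift k x.
Proof.
apply/funext => -[|j w]; rewrite /L /lmul /zvar.
  by rewrite big_ord_recl big_ord0 /= fshift_nil mul0r addr0.
rewrite big_ord_recl [take _ _]/= mul0r add0r big_ord_recl /= take0 drop0 big1 ?addr0.
  rewrite eqseq_cons eqxx andbT; case: (j =P k) => [->|/eqP jk].
    by rewrite mul1r fshift_cons.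
  by rewrite mul0r fshift_cons_neq.
move=> i _ /=; case: w i => [[]//|a w] i /=.
by rewrite !eqseq_cons andbF mul0r.
Qed.

Lemma L_bounded_linear (k : letter d) : bounded_linear (L k : op R _ _).
Proof.
apply: bounded_linear_ext (unpack_bounded_linear (fshift_blin k)) => f lf.
by rewrite /unpack -L_fshift to_l2vecK.
Qed.

Lemma pack_L (k : letter d) : pack (L k) = fshift k :> (H -> H).
Proof. by apply/funext => x; rewrite /pack L_fshift l2valK. Qed.

Lemma adj_L (k : letter d) (x : H) : adj (L k) x = fshift' k x.
Proof. by rewrite (adj_pack (L_bounded_linear k)) pack_L hadj_fshift. Qed.

(** [rmul F h] is the product of [h] by the transposed series of [F], on the right. *)
Lemma rmulE F h w : rmul F h w =
  \sum_(i < (size w).+1) h (take i w) * F (rev (drop i w)).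
Proof.
rewrite /rmul /transp /lmul size_rev (reindex_inj rev_ord_inj) /=.
apply: eq_bigr => i _; rewrite subSS take_rev drop_rev mulrC revK.
have iw : (i <= size w)%N by rewrite -ltnS.
by rewrite subKn.
Qed.

Lemma rmul_lin F (z : R[i]) f g :
  rmul F (fun i => z * f i + g i) = (fun w => z * rmul F f w + rmul F g w).
Proof.
apply/funext => w; rewrite !rmulE mulr_sumr -big_split; apply: eq_bigr => i _ /=.
by rewrite mulrDl mulrA.
Qed.

Lemma norm2_transp f : norm2 (transp f) = norm2 f.
Proof.
rewrite /norm2 [RHS](@reindex_esum _ _ _ [set: word d] _ (fun w : word d => rev w : word d))//.
split=> //; first by move=> w w' _ _ /(can_inj revK).
by move=> w _; exists (rev w) => //; exact: revK.
Qed.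

Lemma rmul_norm2_le F (M : \bar R) :
  (forall h, l2 h -> (norm2 (lmul F h) <= M * norm2 h)%E) ->
  forall h, l2 h -> (norm2 (rmul F h) <= M * norm2 h)%E.
Proof.
move=> le h lh; rewrite /rmul norm2_transp -(norm2_transp h).
by apply: le; rewrite /l2 norm2_transp.
Qed.

Lemma rmul_bounded_linear F : Hinf F -> bounded_linear (rmul F).
Proof.
move=> [M FM]; split; last by move=> z x y _ _; exact: rmul_lin.
by exists M; exact: rmul_norm2_le.
Qed.

Lemma Hinf_ball_Hinf F : Hinf_ball F -> Hinf F.
Proof. by move=> F1; exists 1 => h lh; rewrite expr1n mul1e; exact: F1. Qed.

Lemma rmul_contraction F : Hinf_ball F -> contraction (rmul F).
Proof.
move=> F1 h lh; rewrite -[norm2 h]mul1e; apply: rmul_norm2_le lh => g lg.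
by rewrite mul1e; exact: F1.
Qed.

Lemma rmul_vacuum F : rmul F (vacuum : H) = transp F.
Proof.
apply/funext => w; rewrite rmulE big_ord_recl take0 drop0 basis_vecE eqxx mul1r big1 ?addr0//.
case: w => [[]//|j w] i _ /=.
by rewrite /basis_fun /= mul0r.
Qed.

Lemma rmul_nil F h : rmul F h [::] = h [::] * F [::].
Proof. by rewrite rmulE big_ord_recl big_ord0 addr0. Qed.

Lemma rmul_fshift_nil F k (x : H) : rmul F (fshift k x) [::] = 0.
Proof. by rewrite rmul_nil fshift_nil mul0r. Qed.

Lemma rmul_fshift_cons F k j (x : H) w :
  rmul F (fshift k x) (j :: w) = if j == k then rmul F x w else 0.
Proof.
rewrite rmulE big_ord_recl take0 fshift_nil mul0r add0r; case: (j =P k) => [->|/eqP jk].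
  by rewrite rmulE; apply: eq_bigr => i _; rewrite /= fshift_cons.
by rewrite big1// => i _; rewrite /= fshift_cons_neq// mul0r.
Qed.

Definition rmulH F : H -> H := pack (rmul F).

Section Bounded.
Context {F : series R d} (Fb : Hinf F).

Lemma rmulHE (x : H) : l2val (rmulH F x) = rmul F x.
Proof. exact: packE (rmul_bounded_linear Fb) x. Qed.

Lemma rmulH_blin : blin (rmulH F). Proof. exact: pack_blin (rmul_bounded_linear Fb). Qed.

Lemma rmulH_fshift k (x : H) : rmulH F (fshift k x) = fshift k (rmulH F x).
Proof.
apply: l2vec_ext => -[|j w]; rewrite rmulHE ?rmul_fshift_nil ?fshift_nil// rmul_fshift_cons.
case: (j =P k) => [->|/eqP jk]; first by rewrite fshift_cons rmulHE.
by rewrite fshift_cons_neq.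
Qed.

Lemma gramE (x : H) : gram F x = l2val (hadj (rmulH F) (rmulH F x)).
Proof. by rewrite /gram -rmulHE (adj_pack (rmul_bounded_linear Fb)). Qed.

Lemma inner_gram (x : H) : inner x (gram F x) = (nsq (rmulH F x))%:C.
Proof. by rewrite gramE inner_dot nsq_gram//; exact: rmulH_blin. Qed.

(** At a word of minimal length in the transpose of [F], the product with [x] is the
    constant term of [x] times the coefficient of [F]. *)
Lemma rmul_vacuum_bound : F <> (fun=> 0) ->
  exists2 c : R, 0 <= c & forall x : H, sqmod (x [::]) <= c * nsq (rmulH F x).
Proof.
move=> F0.
have [w Fw] : exists w, F (rev w) != 0.
  apply: contrapT => no; apply: F0; apply/funext => w; apply/eqP/negPn/negP => Fw.
  by apply: no; exists (rev w); rewrite revK.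
pose P n := `[< exists2 w : word d, size w = n & F (rev w) != 0 >].
have exP : exists n, P n by exists (size w); apply/asboolP; exists w.
case: (ex_minnP exP) => n /asboolP [t tn Ft] min.
have Fp : 0 < sqmod (F (rev t)).
  rewrite lt_neqAle sqmod_ge0 andbT eq_sym; apply: contraNneq Ft => /sqmod_eq0 ->.
  by rewrite eqxx.
exists (sqmod (F (rev t)))^-1; first by rewrite invr_ge0 ltW.
move=> x; rewrite mulrC ler_pdivlMr// -sqmodM.
suff <- : rmulH F x t = x [::] * F (rev t) by exact: sqmod_coord_le.
rewrite rmulHE rmulE big_ord_recl take0 drop0 big1 ?addr0// => i _.
have [->|Fi] := eqVneq (F (rev (drop (lift ord0 i) t))) 0; first by rewrite mulr0.
have lt : (size (drop (lift ord0 i) t) < n)%N.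
  by rewrite size_drop -tn ltn_subrL /= (leq_ltn_trans _ (ltn_ord i)).
have : P (size (drop (lift ord0 i) t)) by apply/asboolP; exists (drop (lift ord0 i) t).
by move=> /min; rewrite leqNgt lt.
Qed.

End Bounded.

(** ** Columns *)

Lemma norm2_column n (f : vec R (word d * 'I_n)%type) :
  norm2 f = (\sum_(j < n) norm2 (fun w => f (w, j)))%E.
Proof.
have pos p : (0 <= (sqmod (f p))%:E)%E by rewrite lee_fin sqmod_ge0.
rewrite {1}/norm2.
have -> : [set: word d * 'I_n] = [set: word d] `*`` (fun=> [set: 'I_n]).
  by apply/seteqP; split.
rewrite (_ : \esum_(i in _) _ =
    \esum_(p in [set: word d] `*`` (fun=> [set: 'I_n])) (sqmod (f (p.1, p.2)))%:E)%E; last first.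
  by apply: eq_esum => -[].
rewrite -(@esum_esum _ _ _ _ _ (fun w j => (sqmod (f (w, j)))%:E))//.
rewrite -esum_sum//; apply: eq_esum => w _.
have E : [set: 'I_n] = [set` enum 'I_n] by apply/seteqP; split=> // j _ /=; rewrite mem_enum.
rewrite E esum_fset; [|exact: finite_seq|by move=> j _; exact: pos].
by rewrite -fsbig_seq ?enum_uniq// big_enum.
Qed.

Lemma norm2_cmul n (c : column n) h : norm2 (cmul c h) = (\sum_(j < n) norm2 (rmul (c j) h))%E.
Proof. exact: norm2_column. Qed.

End Multiplication.

Section ColumnOperators.
Context {R : realType} {d : option nat}.
Local Notation H := (l2vec R (word d)).

Definition cons_col {n} (k : letter d) (p : (word d * 'I_n)%type) : (word d * 'I_n)%type :=
  (k :: p.1, p.2).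

Lemma cons_col_inj n (k k' : letter d) (p p' : (word d * 'I_n)%type) :
  cons_col k p = cons_col k' p' -> k = k' /\ p = p'.
Proof. by case: p p' => [w i] [w' i'] [-> -> ->]. Qed.

Definition cmulH {n} (c : column (R := R) (d := d) n) : H -> l2vec R (word d * 'I_n)%type :=
  pack (cmul c).

Section Contractive.
Context {n : nat} (c : column (R := R) (d := d) n).
Hypothesis c1 : contraction (cmul c).
Hypothesis cb : forall j, Hinf (c j).

Lemma cmul_bounded_linear : bounded_linear (cmul c).
Proof.
split; first by exists 1 => h lh; rewrite expr1n mul1e; exact: c1.
by move=> z x y _ _; apply/funext => p; rewrite /cmul rmul_lin.
Qed.

Lemma cmulHE (x : H) p : cmulH c x p = rmul (c p.2) x p.1.
Proof. by rewrite /cmulH -[LHS]/(l2val (pack (cmul c) x) p) (packE cmul_bounded_linear). Qed.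

Lemma nsq_cmulH x : nsq (cmulH c x) = \sum_(j < n) nsq (rmulH (c j) x).
Proof.
apply: EFin_inj; rewrite -norm2_nsq (packE cmul_bounded_linear) norm2_cmul -sumEFin.
by apply: eq_bigr => j _; rewrite -norm2_nsq rmulHE.
Qed.

Lemma cmulH_fshift k x :
  cmulH c (fshift k x) = push (cons_col k) (@s_inj1 _ _ _ (@cons_col_inj n) k) (cmulH c x).
Proof.
apply: l2vec_ext => -[[|j w] i]; rewrite cmulHE.
  by rewrite rmul_fshift_nil push_out// => -[].
rewrite rmul_fshift_cons; case: (j =P k) => [->|jk].
  by rewrite -[X in push _ _ _ X]/(cons_col k (w, i)) push_in cmulHE.
by rewrite push_out// => -[w' i'] [/esym].
Qed.

Lemma ampl_adj_L k : ampl (adj (L k)) (ctransp c) =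
  l2val (pull (@s_inj1 _ _ _ (@cons_col_inj n) k) (cmulH c vacuum)).
Proof.
apply/funext => -[w i]; rewrite pullE cmulHE /ampl /ctransp /= rmul_vacuum.
rewrite (_ : (fun w => transp (c i) w) = l2val (rmulH (c i) vacuum)).
  by rewrite adj_L fshift'E rmulHE// rmul_vacuum.
by rewrite rmulHE// rmul_vacuum.
Qed.

End Contractive.

Lemma nsq_vacuum : nsq (vacuum : H) = 1.
Proof. by rewrite nsqE dot_vacuum basis_vecE eqxx. Qed.

(** In the model, the backward shifts lose from the first component the constant terms
    of [C 1], of total squared modulus [eps], and from the second one the squared
    distance [beta]; before that, the two components have total squared norm
    [|C 1|^2 + |D 1|^2 = 1]. *)
Lemma esum_dbr_norm2 {J : choiceType} (s : letter d -> J -> J)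
    (s_inj : forall k k' j j', s k j = s k' j' -> k = k' /\ j = j')
    (T : op R (word d) J) (Z : set J) (beta eps : R) :
  bounded_linear T -> contraction T ->
  (forall k x, pack T (fshift k x) = push (s k) (@s_inj1 _ _ _ s_inj k) (pack T x)) ->
  (forall k j, ~ Z (s k j)) -> (forall j, ~ Z j -> exists k j', j = s k j') ->
  (\esum_(j in Z) (sqmod (pack T vacuum j))%:E = eps%:E)%E ->
  esumT (fun k => nsq (wold' (pack T) k (defect (pack T) vacuum))) =
    (nsq (defect (pack T) vacuum) - beta)%:E ->
  (\esum_(k in [set: letter d])
     dbr_norm2 T (pull (@s_inj1 _ _ _ s_inj k) (pack T vacuum)) = (1 - beta - eps)%:E)%E.
Proof.
move=> Tb T1 CL sZ Zs Zeps Vbeta.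
have Cb := pack_blin Tb; have C1 := contraction_opb Tb T1.
set C := pack T in CL Zeps Vbeta Cb C1 *.
have split := norm2_split (C vacuum) s_inj sZ Zs.
pose f k := nsq (pull (@s_inj1 _ _ _ s_inj k) (C vacuum)).
pose g k := nsq (wold' C k (defect C vacuum)).
have fE : esumT f = (nsq (C vacuum) - eps)%:E.
  move: split; rewrite norm2_nsq Zeps.
  rewrite (_ : \esum_(k in _) _ = esumT f)%E; last first.
    by apply: eq_esum => k _; rewrite -norm2_nsq.
  have : (0 <= esumT f)%E by apply: esumT_ge0 => k; exact: nsq_ge0.
  by case: (esumT f) => [r|//|//] _ [] ->; rewrite addrK.
rewrite (_ : \esum_(k in _) _ = esumT (fun k => (f k + g k)%R))%E; last first.
  apply: eq_esum => k _; apply: dbr_norm2_model => //.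
  exact: (model_pair_pull Cb C1 CL).
rewrite esumTD => [|k|k]; [|exact: nsq_ge0|exact: nsq_ge0].
rewrite fE Vbeta -EFinD (nsq_defect Cb C1) nsq_vacuum; congr (_%:E); ring.
Qed.

End ColumnOperators.

(** * The Sarason function *)

Section Columns2.
Context {R : realType} {d : option nat}.
Local Notation H := (l2vec R (word d)).
Implicit Types f g : series R d.

Lemma col2_Hinf f g j : Hinf f -> Hinf g -> Hinf (col2 f g j).
Proof. by move=> fb gb; rewrite /col2; case: ifP. Qed.

Lemma nsq_col2 f g (x : H) : Hinf f -> Hinf g -> contraction (cmul (col2 f g)) ->
  nsq (cmulH (col2 f g) x) = nsq (rmulH f x) + nsq (rmulH g x).
Proof.
move=> fb gb c1; rewrite nsq_cmulH//; last by move=> j; exact: col2_Hinf.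
by rewrite !big_ord_recl big_ord0 addr0.
Qed.

Lemma col2_contraction f g : Hinf f -> Hinf g ->
  (forall x : H, nsq (rmulH f x) + nsq (rmulH g x) <= nsq x) ->
  contraction (cmul (col2 f g)).
Proof.
move=> fb gb le h lh; rewrite norm2_cmul !big_ord_recl big_ord0 adde0 -(to_l2vecK lh).
rewrite [col2 f g _]/= -[col2 f g (lift _ _)]/g -(rmulHE fb) -(rmulHE gb).
by rewrite !norm2_nsq -EFinD lee_fin.
Qed.

Lemma contraction_nsq {n} (c : column (R := R) (d := d) n) (x : H) :
  contraction (cmul c) -> nsq (cmulH c x) <= nsq x.
Proof.
move=> c1; rewrite -lee_fin -!norm2_nsq (packE (cmul_bounded_linear c1)).
by apply: c1; exact: l2valP.
Qed.

Lemma cons_inj2 (k k' : letter d) (w w' : word d) : k :: w = k' :: w' -> k = k' /\ w = w'.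
Proof. by case=> -> ->. Qed.

Lemma rmulH_push f (k : letter d) (x : H) : Hinf f ->
  rmulH f (fshift k x) = push (fun w : word d => k :: w) (@s_inj1 _ _ _ cons_inj2 k) (rmulH f x).
Proof.
by move=> fb; rewrite rmulH_fshift// /fshift; congr (push _ _ _); exact: Prop_irrelevance.
Qed.

End Columns2.

Section Toepl.
Context {R : realType} {d : option nat} {b : series R d}.
Local Notation H := (l2vec R (word d)).
Hypothesis b_ball : Hinf_ball b.
Let b_Hinf := Hinf_ball_Hinf b_ball.
Let Tb := rmul_bounded_linear b_Hinf.
Local Notation D := (defect (rmulH b)).

Lemma rmulH_opb : opb 1 (rmulH b).
Proof. exact: contraction_opb Tb (rmul_contraction b_ball). Qed.

Lemma toeplE (x : H) : toepl b x = l2val (D (D x)).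
Proof.
rewrite (defectK (rmulH_blin b_Hinf) rmulH_opb) /toepl.
by apply/funext => w; rewrite /= (gramE b_Hinf).
Qed.

Lemma inner_toepl (x : H) : inner x (toepl b x) = (nsq (D x))%:C.
Proof.
rewrite toeplE inner_dot (defect_adjoint (rmulH_blin b_Hinf) rmulH_opb) dotxx.
by [].
Qed.

Lemma toepl_bounded_linear : bounded_linear (toepl b).
Proof.
have Db := defect_blin (rmulH_blin b_Hinf) rmulH_opb.
apply: bounded_linear_ext (unpack_bounded_linear (blin_comp Db Db)) => f lf.
by rewrite /unpack -toeplE to_l2vecK.
Qed.

Lemma toepl_positive : positive (toepl b).
Proof.
by move=> h lh; rewrite -(to_l2vecK lh) inner_toepl ler0c nsq_ge0.
Qed.

Lemma toepl_left_toeplitz : left_toeplitz (toepl b).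
Proof.
move=> j k h lh; rewrite -(to_l2vecK lh) L_fshift toeplE adj_L.
rewrite (fshift'_defect2 (rmulH_blin b_Hinf) rmulH_opb (fun k x => rmulH_push k x b_Hinf)).
by case: (j == k); rewrite ?toeplE.
Qed.

(** If [e] completes [b] to a contractive column, then [|e(R) x|] is at most the
    defect norm, and [e(R) x] still sees the constant term of [x]. *)
Lemma non_column_extreme_bound : ~ column_extreme b ->
  exists2 c : R, 0 <= c & forall x : H, sqmod (x [::]) <= c * nsq (D x).
Proof.
move=> /contrapT [e [eb e0 be]].
have [c c0 cx] := rmul_vacuum_bound eb e0; exists c => // x.
apply: le_trans (cx x) _; apply: ler_wpM2l => //.
rewrite (nsq_defect (rmulH_blin b_Hinf) rmulH_opb).
by have := contraction_nsq x be; rewrite nsq_col2//; lra.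
Qed.

End Toepl.

Lemma posc_real {R : realType} (z : R[i]) : 0 < z ->
  z = (complex.Re z)%:C /\ 0 < complex.Re z.
Proof. by case: z => x y; rewrite ltcE /= => /andP [/eqP -> ->]. Qed.

Section Sarason.
Context {R : realType} {d : option nat} {b a : series R d}.
Local Notation H := (l2vec R (word d)).
Hypothesis b_ball : Hinf_ball b.
Hypothesis a_ball : Hinf_ball a.
Let b_Hinf := Hinf_ball_Hinf b_ball.
Let a_Hinf := Hinf_ball_Hinf a_ball.
Let Tb := rmul_bounded_linear b_Hinf.
Let T1 := rmul_contraction b_ball.
Let Cb := rmulH_blin b_Hinf.
Let C1 := rmulH_opb b_ball.
Let CL := fun k x => rmulH_push k x b_Hinf.
Local Notation D := (defect (rmulH b)).
Local Notation alpha := (complex.Re (a [::])).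

Variable u : H.
Hypothesis uK : defect_space (rmulH b) u.
Hypothesis Du : D u = vacuum.
Hypothesis u_approx : forall e, 0 < e -> exists2 p, fsupp p & nsq (u - D p) < e.

(** The auxiliary square root of [1 / |u|^2] stands for [a(0)], whose value is derived
    from this formula. *)
Lemma bold_norm2_root : bold_norm2 b = (1 - (nsq u)^-1 - sqmod (b [::]))%:E.
Proof.
have u0 : 0 < nsq u.
  rewrite lt_neqAle nsq_ge0 andbT eq_sym; apply/eqP => /nsq_eq0 u0.
  have := dot_root Cb C1 Du vacuum; rewrite u0 dot0l basis_vecE eqxx.
  by move/eqP; rewrite eq_sym oner_eq0.
pose al := Num.sqrt (nsq u)^-1.
have al0 : 0 < al by rewrite sqrtr_gt0 invr_gt0.
have al2 : al ^+ 2 = (nsq u)^-1 by rewrite sqr_sqrtr// invr_ge0 ltW.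
have alE : al ^+ 2 * nsq u = 1 by rewrite al2 mulVf ?gt_eqF.
have bold := esum_wold'_root Cb C1 CL Du u_approx alE.
have Z1 (k : letter d) (w : word d) : ~ [set [::]] (k :: w) by [].
have Z2 (w : word d) : ~ [set [::]] w -> exists k w', w = k :: w'.
  by case: w => [/(_ erefl)|k w] // _; exists k, w.
have Z3 : (\esum_(w in [set [::]]) (sqmod (rmulH b vacuum w))%:E = (sqmod (b [::]))%:E)%E.
  by rewrite esum_set1 ?lee_fin ?sqmod_ge0// (rmulHE b_Hinf) rmul_vacuum.
rewrite -al2 -(esum_dbr_norm2 Tb T1 CL Z1 Z2 Z3 bold).
rewrite /bold_norm2; apply: eq_esum => k _; congr dbr_norm2.
by rewrite -(rmul_vacuum b) -(rmulHE b_Hinf) adj_L.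
Qed.

Hypothesis a_sarason : is_sarason b a.

Lemma sarason_real : a [::] = alpha%:C /\ 0 < alpha.
Proof. by case: a_sarason => /posc_real. Qed.

Lemma sarason_alpha : alpha ^+ 2 * nsq u = 1.
Proof.
have [_ + _] := a_sarason; rewrite bold_norm2_root => -[al].
have -> : alpha ^+ 2 = (nsq u)^-1 by rewrite al; ring.
rewrite mulVf//; apply/eqP => u0.
have [_ a0] := sarason_real; have : 0 < alpha ^+ 2 by rewrite exprn_gt0.
have -> : alpha ^+ 2 = (nsq u)^-1 by rewrite al; ring.
by rewrite u0 invr0 ltxx.
Qed.

Let alE := sarason_alpha.
Let al0 : 0 < alpha. Proof. by case: sarason_real. Qed.

Local Notation outer_factor := (outer_factor Cb C1 CL uK Du alE).

(** Both sides commute with the shifts, so it is enough to compare the coefficients of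
    their values at 1. *)
Lemma sarason_outer_factor : rmulH a = outer_factor.
Proof.
apply: commutant_ext.
- exact: rmulH_blin.
- exact: outer_factor_blin.
- by move=> k x; exact: rmulH_fshift.
- by move=> k x; exact: outer_factor_fshift.
apply: l2vec_ext => w; rewrite (rmulHE a_Hinf) rmul_vacuum /transp.
have [->|w0] := eqVneq w [::].
  by rewrite outer_factor_vacuum_nil; case: sarason_real.
have [_ _ ->] := a_sarason; last first.
  by move=> e; case/eqP: w0; rewrite -[w]revK e.
have rw0 : rev w != [::] by rewrite -size_eq0 size_rev size_eq0.
rewrite -[in RHS](revK w) -(sarason_coefficient Cb C1 CL uK Du alE rw0).
have tb : transp b = l2val (rmulH b vacuum) by rewrite (rmulHE b_Hinf) rmul_vacuum.
have Xp t : Xpow t (transp b) =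
    l2val (backward_pull cons_inj2 (rmulH b) t).
  elim: t => [|k t IH]; first by rewrite tb.
  by rewrite /Xpow /= -/(Xpow t _) IH adj_L.
rewrite Xp tb (dbr_inner_model Tb T1 (model_pair_vacuum Cb C1 uK Du)
  (model_pair_backward Cb C1 CL uK Du _)).
have [aE _] := sarason_real.
by rewrite mulNr; congr (- (_ * _)); exact: aE.
Qed.

Lemma sarason_defect_le (x : H) : nsq (rmulH a x) <= nsq (D x).
Proof. by rewrite sarason_outer_factor; exact: outer_factor_le. Qed.

Lemma sarason_outer : outer a.
Proof.
split=> // g eps lg e0.
have [|x Hx] := dense_range (rmulH_blin a_Hinf) _ (L2Vec lg) e0.
  by rewrite sarason_outer_factor => y; exact: outer_factor_ker.
exists x; first exact: l2valP.
by rewrite -(rmulHE a_Hinf) -lte_fin -norm2_nsq in Hx *.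
Qed.

Lemma sarason_maximal : maximal_outer_factor (toepl b) a.
Proof.
split; first by split; [exact: toepl_bounded_linear|exact: toepl_positive|exact: toepl_left_toeplitz].
split.
- exact: sarason_outer.
- move=> h lh; rewrite -(to_l2vecK lh) (inner_gram a_Hinf) (inner_toepl b_ball) lecR.
  exact: sarason_defect_le.
move=> h [h_Hinf _] hT g lg; rewrite -(to_l2vecK lg) (inner_gram a_Hinf) (inner_gram h_Hinf) lecR.
rewrite sarason_outer_factor.
apply: (outer_factor_maximal Cb C1 CL uK Du al0).
- exact: rmulH_blin.
- by move=> k x; exact: rmulH_fshift.
move=> x; have := hT x (l2valP x).
by rewrite (inner_gram h_Hinf) (inner_toepl b_ball) lecR.
Qed.

Lemma sarason_inf : (alpha ^+ 2)%:E =
  ereal_inf [set (complex.Re (inner (fone \- p) (toepl b (fone \- p))))%:E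
            | p in [set p : series R d | free_poly p /\ p [::] = 0]].
Proof.
have val (p : series R d) : l2 p ->
    complex.Re (inner (fone \- p) (toepl b (fone \- p))) = nsq (D (vacuum - to_l2vec p)).
  move=> lp; rewrite (_ : fone \- p = l2val (vacuum - to_l2vec p)); last first.
    by apply/funext => w; rewrite /= to_l2vecK.
  by rewrite inner_toepl.
apply/eqP; rewrite eq_le; apply/andP; split.
  apply/ereal_infP => _ [p [pf p0] <-]; rewrite lee_fin val; last exact: l2_fsupp.
  apply: (defect_lower Cb C1 Du alE).
  by rewrite l2valD l2valN basis_vecE eqxx to_l2vecK ?p0 ?subr0//; exact: l2_fsupp.
apply/lee_addgt0Pr => e e0.
have [q [qf q1 qe]] := defect_upper Cb C1 Du u_approx alE e0.
have pf : fsupp (vacuum - q : H).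
  rewrite addrC -scaleN1r; apply: fsupp_lin => //; exact: fsupp_delta.
apply: ereal_inf_le; exists (nsq (D q))%:E; last by rewrite -EFinD lee_fin ltW.
exists (l2val (vacuum - q)).
  by split=> //; rewrite l2valD l2valN basis_vecE eqxx q1 subrr.
rewrite val; last exact: l2valP.
by rewrite l2valK opprB addrC subrK.
Qed.

(** ** The column [(b, a)] *)

Local Notation c := (col2 b a).

Lemma sarason_column_contraction : contraction (cmul c).
Proof.
apply: col2_contraction => // x; have := sarason_defect_le x.
by rewrite (nsq_defect Cb C1); lra.
Qed.

Let c1 := sarason_column_contraction.
Let cH j : Hinf (c j). Proof. exact: col2_Hinf. Qed.
Let Tcb := cmul_bounded_linear c1.
Let Ccb : blin (cmulH c) := pack_blin Tcb.
Let Cc1 : opb 1 (cmulH c) := contraction_opb Tcb c1.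

Lemma nsq_defect_column x : nsq (defect (cmulH c) x) = nsq (D x) - nsq (rmulH a x).
Proof.
rewrite [LHS](nsq_defect Ccb Cc1 x) [X in _ - X](nsq_col2 x b_Hinf a_Hinf c1).
by rewrite [X in _ = X - _](nsq_defect Cb C1 x) opprD addrA.
Qed.

(** The defect of the column has no distance left between the vacuum and the
    polynomials without constant term: [a] has used it up. *)
Lemma defect_column_small e : 0 < e ->
  exists p : H, [/\ fsupp p, p [::] = 1 & nsq (defect (cmulH c) p) < 0 + e].
Proof.
move=> e0; have [p [pf p1 pe]] := defect_upper Cb C1 Du u_approx alE e0.
exists p; split=> //; rewrite nsq_defect_column.
have := sqmod_coord_le (rmulH a p) [::].
rewrite (rmulHE a_Hinf) rmul_nil p1 mul1r; have [-> _] := sarason_real.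
rewrite sqmodC; move: pe; lra.
Qed.

Lemma sarason_column_extreme : column_extreme2 c.
Proof.
split=> // -[e [eH e0 e1]].
have [j ej] : exists j, e j <> (fun=> 0).
  apply: contrapT => no; apply: e0; apply/funext => j; apply: contrapT => ej.
  by apply: no; exists j.
have [k k0 kx] := rmul_vacuum_bound (eH j) ej.
have sH i : Hinf (stack c e i) by rewrite /stack; case: fintype.split => i'.
(* The rows of [e] other than [j] only help. *)
have le (x : H) : nsq (rmulH (e j) x) <= nsq (defect (cmulH c) x).
  have := contraction_nsq x e1; rewrite nsq_cmulH// big_split_ord /=.
  have -> : \sum_(i < 2) nsq (rmulH (stack c e (lshift 2 i)) x) = nsq (cmulH c x).
    rewrite nsq_cmulH//; apply: eq_bigr => i _; rewrite /stack.
    by have := @unsplitK 2 2 (inl i); rewrite /unsplit => ->.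
  rewrite (bigD1 j)//= (_ : stack c e (rshift 2 j) = e j); last first.
    by rewrite /stack; have := @unsplitK 2 2 (inr j); rewrite /unsplit => ->.
  rewrite (nsq_defect Ccb Cc1); set r := \sum_(i | _) _.
  have : 0 <= r by apply: sumr_ge0 => i _; exact: nsq_ge0.
  lra.
have kp : 0 < k + 1 by lra.
have [|p [_ p1 pe]] := @defect_column_small (k + 1)^-1; first by rewrite invr_gt0.
have := kx p; rewrite p1 sqmod1; move: pe; rewrite add0r => pe.
have : (k + 1) * nsq (defect (cmulH c) p) < 1 by rewrite -ltr_pdivlMl// mulr1.
have := le p; have := nsq_ge0 (rmulH (e j) p); nra.
Qed.

Lemma sarason_column_norm : cbold_norm2 c = bold_norm2 b.
Proof.
have CLc k x := cmulH_fshift c1 k x.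
have zero : esumT (fun k => nsq (wold' (cmulH c) k (defect (cmulH c) vacuum))) =
    (nsq (defect (cmulH c) vacuum) - 0)%:E.
  apply: (esum_wold' Ccb Cc1 CLc) => [t _|e e0]; first exact: nsq_ge0.
  exact: defect_column_small.
have Z1 (k : letter d) (p : (word d * 'I_2)%type) :
  ~ [set p | p.1 = [::]] (cons_col k p) by [].
have Z2 (p : (word d * 'I_2)%type) : ~ [set p | p.1 = [::]] p ->
    exists k p', p = cons_col k p'.
  by case: p => -[|k w] i /=; [case|exists k, (w, i)].
have Z3 : (\esum_(p in [set p : (word d * 'I_2)%type | p.1 = [::]])
    (sqmod (cmulH c vacuum p))%:E = (sqmod (b [::]) + alpha ^+ 2)%:E)%E.
  have <- : [set` [:: ([::] : word d, ord0 : 'I_2); ([::] : word d, lift ord0 ord0 : 'I_2)]] =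
      [set p : (word d * 'I_2)%type | p.1 = [::]].
    apply/seteqP; split=> [p /=|[w i] /= ->]; rewrite !inE.
      by move=> /orP [] /eqP ->.
    by case: i => -[|[|//]] i; rewrite !xpair_eqE.
  rewrite esum_fset; [|exact: finite_seq|by move=> p _; rewrite lee_fin sqmod_ge0].
  rewrite -fsbig_seq// big_cons big_seq1 !(cmulHE c1) !rmul_vacuum /transp /=.
  have -> : col2 b a (lift ord0 ord0) = a by [].
  have [aE _] := sarason_real.
  have -> : sqmod (a [::]) = alpha ^+ 2 by rewrite {1}aE sqmodC.
  by rewrite EFinD.
rewrite (bold_norm2_root).
have -> : 1 - (nsq u)^-1 - sqmod (b [::]) = 1 - 0 - (sqmod (b [::]) + alpha ^+ 2) :> R.
  have -> : (nsq u)^-1 = alpha ^+ 2.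
    have := alE; have [->|u0] := eqVneq (nsq u) 0; last by move=> h; apply: (mulIf u0); rewrite h mulVf.
    by rewrite mulr0 => /eqP; rewrite eq_sym oner_eq0.
  by ring.
rewrite -(esum_dbr_norm2 Tcb c1 CLc Z1 Z2 Z3 zero) /cbold_norm2.
by apply: eq_esum => k _; rewrite (ampl_adj_L c1 cH).
Qed.

End Sarason.

Theorem corollary1 (R : realType) (d : option nat) (b a : series R d)
    (b_ball : Hinf_ball b) (b_nonCE : ~ column_extreme b)
    (a_ball : Hinf_ball a) (a_sarason : is_sarason b a) :
  [/\ maximal_outer_factor (toepl b) a,
      (complex.Re (a [::]) ^+ 2)%:E =
        ereal_inf [set (complex.Re (inner (fone \- p) (toepl b (fone \- p))))%:E
                  | p in [set p : series R d | free_poly p /\ p [::] = 0]],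
      column_extreme2 (col2 b a) &
      cbold_norm2 (col2 b a) = bold_norm2 b].
Proof.
have [k k0 bound] := non_column_extreme_bound b_ball b_nonCE.
have b_Hinf := Hinf_ball_Hinf b_ball.
have [u [uK Du u_approx]] :=
  defect_vacuum_root (rmulH_blin b_Hinf) (rmulH_opb b_ball) k0 bound.
split.
- exact: sarason_maximal uK Du u_approx a_sarason.
- exact: sarason_inf u_approx a_sarason.
- exact: sarason_column_extreme uK Du u_approx a_sarason.
- exact: sarason_column_norm uK Du u_approx a_sarason.
Qed.
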